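(* Let $\beta\in\mathbb{R}$ and let $p$ be an analytic function on $\mathbb{D}$ with $p(0)=1$ satisfying $$1+\beta\,\frac{zp'(z)}{p^{2}(z)}\prec\varphi_{CAR}(z).$$ Then the following hold: (a) If $\beta\geq 4$ or $\beta\leq -4/3$, then $p(z)\prec\frac{1+z}{1-z}$. (b) If $\beta>0$ and $0<\alpha<1$ satisfy $$9\alpha^{2}\beta^{2}\left(\frac{1-\alpha}{1+\alpha}\right)^{\alpha}(1-\alpha^{2})^{-2}\left(-8+\alpha^{2}\left(8+3\beta^{2}\left(\frac{1-\alpha}{1+\alpha}\right)^{\alpha}\right)\right)-64\alpha\beta(1-\alpha^{2})^{-\frac12}\left(\sqrt{\frac{1-\alpha}{1+\alpha}}\right)^{\alpha}\sin\left(\frac{\alpha\pi}{2}\right)\geq 16,$$ then $p(z)\prec\left(\frac{1+z}{1-z}\right)^{\alpha}$.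
   Context: $\mathbb{D}$ is the open unit disc in $\mathbb{C}$. $\varphi_{CAR}(z)=1+\frac{4z}{3}+\frac{2z^2}{3}$. For analytic functions $f,g$ on $\mathbb{D}$, $f\prec g$ ($f$ is subordinate to $g$) means there is an analytic $w:\mathbb{D}\to\mathbb{D}$ with $w(0)=0$ and $f(z)=g(w(z))$ for all $z\in\mathbb{D}$; in particular a subordination hypothesis includes that its left-hand side is analytic on $\mathbb{D}$. The power $\left(\frac{1+z}{1-z}\right)^{\alpha}$ is the principal branch (value $1$ at $z=0$). *)

(* Defs.v *)
(* Stdlib real numbers, with Coquelicot's complex numbers and derivatives. *)
From Stdlib Require Export Reals.
From Coquelicot Require Export Coquelicot.
Open Scope R_scope.

Definition disc (z : C) : Prop := Cmod z < 1.

(* [ex_derive] at type [C -> C] is differentiability over the scalar field C,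
   i.e. complex differentiability; [C_derive] is the corresponding derivative.
   Functions on the disc are total functions on C whose values outside the
   disc are irrelevant. *)
Definition analytic_on_disc (f : C -> C) : Prop :=
  forall z : C, disc z -> @ex_derive C_AbsRing C_NormedModule f z.

(* Analyticity of both sides is part of the relation.  When [f] is given by a
   quotient, Coquelicot's convention [x / 0 = 0] applies, so analyticity of [f]
   does not by itself say that the denominator never vanishes. *)
Definition subordinate (f g : C -> C) : Prop :=
  analytic_on_disc f /\ analytic_on_disc g /\
  exists w : C -> C,
    analytic_on_disc w /\
    (forall z : C, disc z -> disc (w z)) /\
    w (RtoC 0) = RtoC 0 /\
    (forall z : C, disc z -> f z = g (w z)).

Definition Cexp (z : C) : C :=
  (exp (Re z) * cos (Im z), exp (Re z) * sin (Im z)).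

(* Principal argument, with values in (-PI, PI] for z <> 0. *)
Definition Carg (z : C) : R :=
  if Rle_dec 0 (Im z) then acos (Re z / Cmod z) else - acos (Re z / Cmod z).

Definition Clog (z : C) : C := (ln (Cmod z), Carg z).

(* Principal branch of the real power of z, meaningful for z <> 0. *)
Definition Cpowr (z : C) (a : R) : C := Cexp (RtoC a * Clog z)%C.

Definition phi_CAR (z : C) : C := (1 + 4 * z / 3 + 2 * z ^ 2 / 3)%C.

(* Main.v *)
(** Put q = 1/p.  The hypothesis reads z q'(z) = -(4 w/3 + 2 w^2/3)/beta with w a
    Schwarz function, and |w(z)| <= |z|.  Integrating along a ray from q(0) = 1
    gives |q - 1| < 5/(3 |beta|), and, for beta < 0, a lower bound on Re q from
    Re(4 w/3 + 2 w^2/3) >= -4t/3 + t^2/3 on |w| <= t.  In case (a) this forces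
    Re q > 0.  In case (b), with v = alpha beta ((1-alpha)/(1+alpha))^(alpha/2)
    / sqrt(1-alpha^2), the hypothesis is
    27 v^4 - 72 v^2 - 64 v sin(alpha pi/2) >= 16, which forces v >= 5/3; since
    ((1-alpha)/(1+alpha))^alpha <= 1 - alpha^2 and sin(alpha pi/2) >= alpha, the disc
    |q - 1| < 5/(3 beta) lies in the sector |arg q| < alpha pi/2.

    Schwarz's lemma is obtained from pointwise complex differentiability alone:
    Goursat's bisection on rectangles in the logarithmic variable gives the mean
    value property at the origin for (punctured) analytic functions, applied to
    f(z)/z it gives |f'(0)| <= 1, Moebius maps turn this into the Schwarz-Pick
    inequality, and integrating that along a ray gives |w(z)| <= |z|. *)

Require Import Defs.
From Stdlib Require Import Reals Lra Lia.
From Coquelicot Require Import Coquelicot.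

(** * Complex derivatives *)

Notation cderiv f z l :=
  (is_derive (K := C_AbsRing) (V := AbsRing_NormedModule C_AbsRing) f z l).

(** The derivative rules used below live over [AbsRing_NormedModule C_AbsRing], whereas
    [analytic_on_disc] uses [C_NormedModule]. Both structures carry the same norm, so only the
    linearity record has to be rebuilt. *)
Lemma cderiv_is_derive (f : C -> C) (z l : C) :
  cderiv f z l <-> is_derive (K := C_AbsRing) (V := C_NormedModule) f z l.
Proof.
  split; intros [H1 H2]; (split; [destruct H1; split; auto | exact H2]).
Qed.

Lemma ex_cderiv (f : C -> C) (z : C) :
  @ex_derive C_AbsRing C_NormedModule f z <-> exists l, cderiv f z l.
Proof.
  split; intros [l Hl]; exists l; apply cderiv_is_derive; exact Hl.
Qed.

Lemma cderiv_spec (f : C -> C) (z l : C) :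
  cderiv f z l <->
  forall eps, 0 < eps -> exists delta, 0 < delta /\
    forall w, Cmod (w - z) < delta ->
      Cmod (f w - f z - (w - z) * l) <= eps * Cmod (w - z).
Proof.
  split.
  - intros [_ H] eps Heps.
    assert (HH : is_filter_lim (locally (T := AbsRing_UniformSpace C_AbsRing) z) z)
      by (intros P HP; exact HP).
    destruct (H z HH (mkposreal eps Heps)) as [d Hd].
    exists d. split. apply d. intros w Hw. apply (Hd w). exact Hw.
  - intros H. split.
    + apply @is_linear_scal_l.
    + intros x Hx eps.
      apply (is_filter_lim_locally_unique (K := C_AbsRing)
               (V := AbsRing_NormedModule C_AbsRing)) in Hx. subst x.
      destruct (H eps (cond_pos eps)) as [d [Hd HH]].
      exists (mkposreal d Hd). intros w Hw. apply (HH w). exact Hw.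
Qed.

Lemma cderiv_id (z : C) : cderiv (fun w => w) z (RtoC 1).
Proof. exact (is_derive_id (K := C_AbsRing) z). Qed.

Lemma cderiv_const (c z : C) : cderiv (fun _ => c) z (RtoC 0).
Proof. exact (is_derive_const (K := C_AbsRing) (V := AbsRing_NormedModule C_AbsRing) c z). Qed.

Lemma cderiv_plus (f g : C -> C) (z df dg : C) :
  cderiv f z df -> cderiv g z dg -> cderiv (fun w => f w + g w)%C z (df + dg)%C.
Proof. exact (is_derive_plus (K := C_AbsRing) (V := AbsRing_NormedModule C_AbsRing) f g z df dg). Qed.

Lemma cderiv_minus (f g : C -> C) (z df dg : C) :
  cderiv f z df -> cderiv g z dg -> cderiv (fun w => f w - g w)%C z (df - dg)%C.
Proof. exact (is_derive_minus (K := C_AbsRing) (V := AbsRing_NormedModule C_AbsRing) f g z df dg). Qed.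

Lemma cderiv_mult (f g : C -> C) (z df dg : C) :
  cderiv f z df -> cderiv g z dg ->
  cderiv (fun w => f w * g w)%C z (df * g z + f z * dg)%C.
Proof.
  intros Hf Hg.
  exact (is_derive_mult (K := C_AbsRing) f g z df dg Hf Hg Cmult_comm).
Qed.

Lemma cderiv_comp (f g : C -> C) (z df dg : C) :
  cderiv f (g z) df -> cderiv g z dg -> cderiv (fun w => f (g w)) z (df * dg)%C.
Proof.
  intros Hf Hg. rewrite Cmult_comm.
  exact (is_derive_comp (K := C_AbsRing) (V := AbsRing_NormedModule C_AbsRing) f g z df dg Hf Hg).
Qed.

Lemma cderiv_ext_ball (f g : C -> C) (z l : C) (r : R) :
  0 < r -> (forall w, Cmod (w - z) < r -> f w = g w) ->
  cderiv f z l -> cderiv g z l.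
Proof.
  intros Hr E. 
  apply (is_derive_ext_loc (K := C_AbsRing) (V := AbsRing_NormedModule C_AbsRing) f g z l).
  exists (mkposreal r Hr). intros w Hw. apply E. exact Hw.
Qed.

Definition ccont (f : C -> C) (z : C) : Prop :=
  forall eps, 0 < eps -> exists delta, 0 < delta /\
    forall w, Cmod (w - z) < delta -> Cmod (f w - f z) < eps.

Lemma Cmod_triangle_minus (a b : C) : Cmod a - Cmod b <= Cmod (a - b).
Proof.
  pose proof (Cmod_triangle (a - b) b).
  replace (a - b + b)%C with a in H by ring. lra.
Qed.

Lemma cderiv_ccont (f : C -> C) (z l : C) : cderiv f z l -> ccont f z.
Proof.
  rewrite cderiv_spec. intros H eps Heps.
  destruct (H 1 Rlt_0_1) as [d [Hd HH]].
  pose proof (Cmod_ge_0 l) as Hl.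
  assert (0 < eps / (1 + Cmod l)) by (apply Rdiv_lt_0_compat; lra).
  exists (Rmin d (eps / (1 + Cmod l))). split. { apply Rmin_glb_lt; lra. }
  intros w Hw.
  pose proof (Rlt_le_trans _ _ _ Hw (Rmin_l _ _)) as H1.
  pose proof (Rlt_le_trans _ _ _ Hw (Rmin_r _ _)) as H2.
  specialize (HH w H1).
  pose proof (Cmod_triangle_minus (f w - f z) ((w - z) * l)) as H3.
  rewrite Cmod_mult in H3.
  apply (Rmult_lt_compat_r (1 + Cmod l)) in H2; [|lra].
  unfold Rdiv in H2. rewrite Rmult_assoc, Rinv_l in H2; lra.
Qed.

Lemma cderiv_inv_id (z : C) : z <> RtoC 0 -> cderiv (fun w => / w)%C z (- / (z * z))%C.
Proof.
  intros Hz. apply cderiv_spec. intros eps Heps.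
  pose proof (Cmod_gt_0 z) as [Hm _]. specialize (Hm Hz).
  set (m := Cmod z) in *.
  assert (Hd : 0 < eps * (m * m * m) / 2).
  { apply Rdiv_lt_0_compat; [|lra]. repeat apply Rmult_lt_0_compat; assumption. }
  (* The remainder is exactly (w - z)^2 / (w z^2). The first bound keeps |w| > m/2, and the second
     then makes |w - z| / (|w| m^2) at most eps. *)
  exists (Rmin (m / 2) (eps * (m * m * m) / 2)). split. { apply Rmin_glb_lt; lra. }
  intros w Hw.
  pose proof (Rlt_le_trans _ _ _ Hw (Rmin_l _ _)) as H1.
  pose proof (Rlt_le_trans _ _ _ Hw (Rmin_r _ _)) as H2.
  assert (Hwm : m / 2 < Cmod w).
  { pose proof (Cmod_triangle_minus z (z - w)).
    replace (z - (z - w))%C with w in H by ring.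
    replace (z - w)%C with (- (w - z))%C in H by ring. rewrite Cmod_opp in H.
    fold m in H. lra. }
  assert (Hw0 : w <> RtoC 0). { apply Cmod_gt_0. lra. }
  replace (/ w - / z - (w - z) * - / (z * z))%C
    with ((w - z) * ((w - z) / (w * (z * z))))%C by (field; auto).
  rewrite Cmod_mult, Cmod_div by (repeat apply Cmult_neq_0; auto).
  rewrite 2!Cmod_mult. fold m.
  rewrite Rmult_comm. apply Rmult_le_compat_r. apply Cmod_ge_0.
  apply Rle_div_l. { apply Rlt_gt. apply Rmult_lt_0_compat; nra. }
  assert (eps * (m * m) * (m / 2) <= eps * (m * m) * Cmod w).
  { apply Rmult_le_compat_l. 2: lra. apply Rlt_le. repeat apply Rmult_lt_0_compat; assumption. }
  lra.
Qed.

Lemma cderiv_inv (f : C -> C) (z df : C) :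
  f z <> RtoC 0 -> cderiv f z df ->
  cderiv (fun w => / f w)%C z (- / (f z * f z) * df)%C.
Proof.
  intros H Hf. exact (cderiv_comp (fun w => / w)%C f z _ _ (cderiv_inv_id _ H) Hf).
Qed.

Lemma cderiv_eq (f : C -> C) (z l l' : C) : l = l' -> cderiv f z l -> cderiv f z l'.
Proof. intros ->. trivial. Qed.

Lemma cderiv_div (f g : C -> C) (z df dg : C) :
  g z <> RtoC 0 -> cderiv f z df -> cderiv g z dg ->
  cderiv (fun w => f w / g w)%C z ((df * g z - f z * dg) / (g z * g z))%C.
Proof.
  intros H Hf Hg. unfold Cdiv at 1.
  refine (cderiv_eq _ _ _ _ _ (cderiv_mult _ _ _ _ _ Hf (cderiv_inv _ _ _ H Hg))).
  field. exact H.
Qed.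

(** * Goursat's theorem on rectangles *)

Lemma differentiable_pt_lim_continuous_1 (f : R -> R -> R) (x y lx ly : R) :
  differentiable_pt_lim f x y lx ly -> continuous (fun t => f t y) x.
Proof.
  intros H. apply (ex_derive_continuous (fun t => f t y)). exists lx.
  apply is_derive_Reals.
  pose proof (derivable_pt_lim_comp_2d f (fun t => t) (fun _ => y) x lx ly 1 0 H
    (derivable_pt_lim_id x) (derivable_pt_lim_const y x)) as H1.
  replace (lx * 1 + ly * 0) with lx in H1 by ring. exact H1.
Qed.

Lemma differentiable_pt_lim_continuous_2 (f : R -> R -> R) (x y lx ly : R) :
  differentiable_pt_lim f x y lx ly -> continuous (fun t => f x t) y.
Proof.
  intros H. apply (ex_derive_continuous (fun t => f x t)). exists ly.
  apply is_derive_Reals.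
  pose proof (derivable_pt_lim_comp_2d f (fun _ => x) (fun t => t) y lx ly 0 1 H
    (derivable_pt_lim_const x y) (derivable_pt_lim_id y)) as H1.
  replace (lx * 0 + ly * 1) with ly in H1 by ring. exact H1.
Qed.

Lemma ex_RInt_continuous_R (f : R -> R) (a b : R) :
  a <= b -> (forall x, a <= x <= b -> continuous f x) -> ex_RInt f a b.
Proof.
  intros Hab Hc. apply (ex_RInt_continuous (V := R_CompleteNormedModule)).
  intros x. rewrite Rmin_left, Rmax_right by lra. apply Hc.
Qed.

Lemma RInt_near_const (f : R -> R) (a b c M : R) :
  a <= b -> (forall x, a <= x <= b -> continuous f x) ->
  (forall x, a <= x <= b -> Rabs (f x - c) <= M) ->
  Rabs (RInt f a b - c * (b - a)) <= M * (b - a).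
Proof.
  intros Hab Hc HM.
  assert (If : ex_RInt f a b).
  { apply ex_RInt_continuous_R; assumption. }
  assert (E : RInt f a b - c * (b - a) = RInt (fun x => minus (f x) c) a b).
  { rewrite (RInt_minus (V := R_CompleteNormedModule)).
    - rewrite RInt_const. unfold minus, plus, opp, scal; simpl; unfold mult; simpl. ring.
    - exact If.
    - apply ex_RInt_const. }
  rewrite E. replace (M * (b - a)) with ((b - a) * M) by ring.
  apply abs_RInt_le_const; trivial.
  apply (ex_RInt_minus (V := R_NormedModule)). exact If. apply ex_RInt_const.
Qed.

(** The intervals [x n, x n + A / 2^n] are nested, so every left endpoint lies below every right
    endpoint; the supremum of the left endpoints belongs to all of them. *)
Lemma nested_halving (A : R) (x : nat -> R) :
  (forall n, x n <= x (S n) /\ x (S n) + A / 2 ^ S n <= x n + A / 2 ^ n) ->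
  0 <= A ->
  exists l, forall n, x n <= l <= x n + A / 2 ^ n.
Proof.
  intros H HA.
  assert (Hw : forall n, 0 <= A / 2 ^ n).
  { intros n. apply Rdiv_le_0_compat. lra. apply pow_lt; lra. }
  assert (Hi : forall n k, x n <= x (n + k)%nat /\ x (n + k)%nat + A / 2 ^ (n + k) <= x n + A / 2 ^ n).
  { intros n. induction k as [|k [IH1 IH2]].
    - rewrite Nat.add_0_r. lra.
    - rewrite Nat.add_succ_r. destruct (H (n + k)%nat). lra. }
  assert (Hub : forall n m, x m <= x n + A / 2 ^ n).
  { intros n m. destruct (Nat.le_ge_cases n m) as [L|L].
    - destruct (Hi n (m - n)%nat) as [_ H2].
      replace (n + (m - n))%nat with m in H2 by lia. pose proof (Hw m). lra.
    - destruct (Hi m (n - m)%nat) as [H2 _].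
      replace (m + (n - m))%nat with n in H2 by lia. pose proof (Hw n). lra. }
  destruct (completeness (fun r => exists n, r = x n)) as [l [L1 L2]].
  - exists (x 0%nat + A / 2 ^ 0). intros r [n ->]. apply Hub.
  - exists (x 0%nat), 0%nat. reflexivity.
  - exists l. intros n. split.
    + apply L1. exists n. reflexivity.
    + apply L2. intros r [m ->]. apply Hub.
Qed.

(** The line integral of P dx + Q dy counterclockwise round the rectangle. *)
Definition circulation (P Q : R -> R -> R) (x1 x2 y1 y2 : R) : R :=
  RInt (fun x => P x y1) x1 x2 + RInt (fun y => Q x2 y) y1 y2
  - RInt (fun x => P x y2) x1 x2 - RInt (fun y => Q x1 y) y1 y2.

(* The same k for both: dP/dy = dQ/dx at each point, without continuity. *)
Definition closed_form_on (P Q : R -> R -> R) (a b c d : R) : Prop :=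
  forall x y, a <= x <= b -> c <= y <= d ->
  exists px k qy, differentiable_pt_lim P x y px k /\ differentiable_pt_lim Q x y k qy.

Lemma closed_form_continuous (P Q : R -> R -> R) (a b c d x y : R) :
  closed_form_on P Q a b c d -> a <= x <= b -> c <= y <= d ->
  continuous (fun t => P t y) x /\ continuous (fun t => Q x t) y.
Proof.
  intros H Hx Hy. destruct (H x y Hx Hy) as (px & k & qy & HP & HQ). split.
  - exact (differentiable_pt_lim_continuous_1 _ _ _ _ _ HP).
  - exact (differentiable_pt_lim_continuous_2 _ _ _ _ _ HQ).
Qed.

(** Each inner edge is traversed once in each direction and cancels; Chasles' relation cuts the
    outer edges. *)
Lemma circulation_split (P Q : R -> R -> R) (a b c d x1 x2 x3 y1 y2 y3 : R) :
  closed_form_on P Q a b c d ->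
  a <= x1 <= x2 -> x2 <= x3 <= b -> c <= y1 <= y2 -> y2 <= y3 <= d ->
  circulation P Q x1 x3 y1 y3 =
    circulation P Q x1 x2 y1 y2 + circulation P Q x2 x3 y1 y2 +
    circulation P Q x1 x2 y2 y3 + circulation P Q x2 x3 y2 y3.
Proof.
  intros H Hx1 Hx2 Hy1 Hy2.
  assert (IP : forall y u v, c <= y <= d -> a <= u <= v -> v <= b ->
                 ex_RInt (fun x => P x y) u v).
  { intros y u v Hy Hu Hv. apply ex_RInt_continuous_R; [lra|]. intros x Hx.
    apply (closed_form_continuous P Q a b c d x y H); lra. }
  assert (IQ : forall x u v, a <= x <= b -> c <= u <= v -> v <= d ->
                 ex_RInt (fun y => Q x y) u v).
  { intros x u v Hy Hu Hv. apply ex_RInt_continuous_R; [lra|]. intros y Hx.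
    apply (closed_form_continuous P Q a b c d x y H); lra. }
  assert (CP : forall y, c <= y <= d -> RInt (fun x => P x y) x1 x3 =
     RInt (fun x => P x y) x1 x2 + RInt (fun x => P x y) x2 x3).
  { intros y Hy. symmetry. apply (RInt_Chasles (V := R_CompleteNormedModule)); apply IP; lra. }
  assert (CQ : forall x, a <= x <= b -> RInt (fun y => Q x y) y1 y3 =
     RInt (fun y => Q x y) y1 y2 + RInt (fun y => Q x y) y2 y3).
  { intros y Hy. symmetry. apply (RInt_Chasles (V := R_CompleteNormedModule)); apply IQ; lra. }
  unfold circulation.
  rewrite (CP y1), (CP y3), (CQ x1), (CQ x3) by lra. ring.
Qed.

(** On a small rectangle containing (x0, y0), P and Q are within eps (w + h) of their affine
    approximations. The affine parts contribute - k h w and k w h, which cancel because dP/dy and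
    dQ/dx are the same k. *)
Lemma circulation_local (P Q : R -> R -> R) (a b c d x0 y0 eps : R) :
  closed_form_on P Q a b c d -> a <= x0 <= b -> c <= y0 <= d -> 0 < eps ->
  exists delta, 0 < delta /\ forall x y w h,
    a <= x <= x0 -> x0 <= x + w <= b -> c <= y <= y0 -> y0 <= y + h <= d ->
    w < delta -> h < delta ->
    Rabs (circulation P Q x (x + w) y (y + h)) <= 2 * eps * (w + h) ^ 2.
Proof.
  intros H Hx0 Hy0 Heps.
  destruct (H x0 y0 Hx0 Hy0) as (px & k & qy & HP & HQ).
  destruct (HP (mkposreal eps Heps)) as [d1 H1].
  destruct (HQ (mkposreal eps Heps)) as [d2 H2]. simpl in H1, H2.
  exists (Rmin d1 d2). split. { apply Rmin_glb_lt. apply d1. apply d2. }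
  intros x y w h Hx Hxw Hy Hyh Hw Hh.
  pose proof (Rmin_l d1 d2) as M1. pose proof (Rmin_r d1 d2) as M2.
  assert (HM : forall u v, x <= u <= x + w -> y <= v <= y + h ->
     Rabs (P u v - P x0 y0 - (px * (u - x0) + k * (v - y0))) <= eps * (w + h) /\
     Rabs (Q u v - Q x0 y0 - (k * (u - x0) + qy * (v - y0))) <= eps * (w + h)).
  { intros u v Hu Hv.
    assert (Rabs (u - x0) <= w) by (apply Rabs_le; lra).
    assert (Rabs (v - y0) <= h) by (apply Rabs_le; lra).
    assert (Rmax (Rabs (u - x0)) (Rabs (v - y0)) <= w + h) by (apply Rmax_lub; lra).
    split.
    - eapply Rle_trans. apply H1; lra. apply Rmult_le_compat_l; lra.
    - eapply Rle_trans. apply H2; lra. apply Rmult_le_compat_l; lra. }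
  assert (CP : forall u v, x <= u <= x + w -> y <= v <= y + h -> continuous (fun t => P t v) u).
  { intros u v Hu Hv. apply (closed_form_continuous P Q a b c d u v H); lra. }
  assert (CQ : forall u v, x <= u <= x + w -> y <= v <= y + h -> continuous (fun t => Q u t) v).
  { intros u v Hu Hv. apply (closed_form_continuous P Q a b c d u v H); lra. }
  (* Opposite sides are paired under one integral: bottom minus top of P is close to - k h, right
     minus left of Q is close to k w. *)
  assert (EP : RInt (fun t => P t y) x (x + w) - RInt (fun t => P t (y + h)) x (x + w)
             = RInt (fun t => minus (P t y) (P t (y + h))) x (x + w)).
  { rewrite (RInt_minus (V := R_CompleteNormedModule)). reflexivity.
    all: apply ex_RInt_continuous_R; [lra|]; intros u Hu; apply CP; lra. }
  assert (EQ : RInt (fun t => Q (x + w) t) y (y + h) - RInt (fun t => Q x t) y (y + h)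
             = RInt (fun t => minus (Q (x + w) t) (Q x t)) y (y + h)).
  { rewrite (RInt_minus (V := R_CompleteNormedModule)). reflexivity.
    all: apply ex_RInt_continuous_R; [lra|]; intros u Hu; apply CQ; lra. }
  assert (BP := RInt_near_const (fun t => minus (P t y) (P t (y + h))) x (x + w)
                  (- (k * h)) (2 * eps * (w + h))).
  assert (BQ := RInt_near_const (fun t => minus (Q (x + w) t) (Q x t)) y (y + h)
                  (k * w) (2 * eps * (w + h))).
  rewrite <- EP in BP. rewrite <- EQ in BQ.
  replace (x + w - x) with w in BP by ring.
  replace (y + h - y) with h in BQ by ring.
  assert (BP' : Rabs (RInt (fun t => P t y) x (x + w) - RInt (fun t => P t (y + h)) x (x + w)
       - - (k * h) * w) <= 2 * eps * (w + h) * w).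
  { apply BP. lra.
    - intros u Hu. apply (continuous_minus (V := R_NormedModule)); apply CP; lra.
    - intros u Hu. destruct (HM u y Hu) as [A1 _]; [lra|].
      destruct (HM u (y + h) Hu) as [A2 _]; [lra|].
      unfold minus, plus, opp; simpl.
      apply Rabs_le_between in A1. apply Rabs_le_between in A2. apply Rabs_le. lra. }
  assert (BQ' : Rabs (RInt (fun t => Q (x + w) t) y (y + h) - RInt (fun t => Q x t) y (y + h)
       - k * w * h) <= 2 * eps * (w + h) * h).
  { apply BQ. lra.
    - intros u Hu. apply (continuous_minus (V := R_NormedModule)); apply CQ; lra.
    - intros u Hu. destruct (HM x u) as [_ A1]; [lra|lra|].
      destruct (HM (x + w) u) as [_ A2]; [lra|lra|].
      unfold minus, plus, opp; simpl.
      apply Rabs_le_between in A1. apply Rabs_le_between in A2. apply Rabs_le. lra. }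
  unfold circulation.
  apply Rabs_le_between in BP'. apply Rabs_le_between in BQ'. apply Rabs_le. lra.
Qed.

Definition dyadic_circulation (P Q : R -> R -> R) (A B : R) (n : nat) (z : R * R) : R :=
  Rabs (circulation P Q (fst z) (fst z + A / 2 ^ n) (snd z) (snd z + B / 2 ^ n)).

(** The first of the four half-size rectangles whose circulation is at least a quarter of the
    present one. The last is taken without a test: when the other three fail, [circulation_split]
    and the triangle inequality force it to qualify. *)
Definition quarter (P Q : R -> R -> R) (A B : R) (n : nat) (z : R * R) : R * R :=
  let w := A / 2 ^ S n in let h := B / 2 ^ S n in
  let big z' := Rle_dec (dyadic_circulation P Q A B n z / 4) (dyadic_circulation P Q A B (S n) z') in
  if big z then z else
  if big (fst z + w, snd z) then (fst z + w, snd z) else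
  if big (fst z, snd z + h) then (fst z, snd z + h) else (fst z + w, snd z + h).

Fixpoint quarters (P Q : R -> R -> R) (A B : R) (z : R * R) (n : nat) : R * R :=
  match n with
  | O => z
  | S m => quarter P Q A B m (quarters P Q A B z m)
  end.

Lemma quarter_range (P Q : R -> R -> R) (A B : R) (n : nat) (z : R * R) :
  0 <= A -> 0 <= B ->
  (fst z <= fst (quarter P Q A B n z) /\
   fst (quarter P Q A B n z) + A / 2 ^ S n <= fst z + A / 2 ^ n) /\
  (snd z <= snd (quarter P Q A B n z) /\
   snd (quarter P Q A B n z) + B / 2 ^ S n <= snd z + B / 2 ^ n).
Proof.
  intros HA HB.
  assert (HP : 0 < 2 ^ S n) by (apply pow_lt; lra).
  assert (EA : A / 2 ^ n = 2 * (A / 2 ^ S n)).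
  { simpl. field. apply pow_nonzero. lra. }
  assert (EB : B / 2 ^ n = 2 * (B / 2 ^ S n)).
  { simpl. field. apply pow_nonzero. lra. }
  assert (0 <= A / 2 ^ S n) by (apply Rdiv_le_0_compat; lra).
  assert (0 <= B / 2 ^ S n) by (apply Rdiv_le_0_compat; lra).
  unfold quarter. cbv zeta. rewrite EA, EB.
  repeat destruct Rle_dec; cbn [fst snd]; lra.
Qed.

Lemma quarter_big (P Q : R -> R -> R) (a b c d A B : R) (n : nat) (z : R * R) :
  closed_form_on P Q a b c d -> 0 <= A -> 0 <= B ->
  a <= fst z -> fst z + A / 2 ^ n <= b -> c <= snd z -> snd z + B / 2 ^ n <= d ->
  dyadic_circulation P Q A B n z / 4 <= dyadic_circulation P Q A B (S n) (quarter P Q A B n z).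
Proof.
  intros H HA HB H1 H2 H3 H4.
  assert (HP : 0 < 2 ^ S n) by (apply pow_lt; lra).
  assert (EA : A / 2 ^ n = A / 2 ^ S n + A / 2 ^ S n).
  { simpl. field. apply pow_nonzero. lra. }
  assert (EB : B / 2 ^ n = B / 2 ^ S n + B / 2 ^ S n).
  { simpl. field. apply pow_nonzero. lra. }
  assert (0 <= A / 2 ^ S n) by (apply Rdiv_le_0_compat; lra).
  assert (0 <= B / 2 ^ S n) by (apply Rdiv_le_0_compat; lra).
  unfold quarter. cbv zeta.
  destruct Rle_dec as [L1|L1]; [exact L1|].
  destruct Rle_dec as [L2|L2]; [exact L2|].
  destruct Rle_dec as [L3|L3]; [exact L3|].
  apply Rnot_le_lt in L1. apply Rnot_le_lt in L2. apply Rnot_le_lt in L3.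
  revert L1 L2 L3. unfold dyadic_circulation. cbn [fst snd]. rewrite EA, EB in *.
  set (w := A / 2 ^ S n) in *. set (h := B / 2 ^ S n) in *.
  rewrite (circulation_split P Q a b c d (fst z) (fst z + w) (fst z + (w + w))
             (snd z) (snd z + h) (snd z + (h + h)) H) by lra.
  replace (fst z + (w + w)) with (fst z + w + w) by ring.
  replace (snd z + (h + h)) with (snd z + h + h) by ring.
  set (c1 := circulation _ _ _ (_ + w) _ (_ + h)).
  set (c2 := circulation P Q (fst z + w) (fst z + w + w) (snd z) (snd z + h)).
  set (c3 := circulation P Q (fst z) (fst z + w) (snd z + h) (snd z + h + h)).
  set (c4 := circulation P Q (fst z + w) (fst z + w + w) (snd z + h) (snd z + h + h)).
  pose proof (Rabs_triang (c1 + c2 + c3) c4).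
  pose proof (Rabs_triang (c1 + c2) c3).
  pose proof (Rabs_triang c1 c2). lra.
Qed.

(** Goursat's argument: after n bisections the circulation is still at least 4^-n times the original
    one, while differentiability at the limit point bounds it by 2 eps (A + B)^2 / 4^n. The factors
    4^n cancel and eps is arbitrary. *)
Lemma circulation_closed (P Q : R -> R -> R) (a b c d : R) :
  a <= b -> c <= d -> closed_form_on P Q a b c d -> circulation P Q a b c d = 0.
Proof.
  intros Hab Hcd H.
  set (A := b - a). set (B := d - c).
  assert (HA : 0 <= A) by (unfold A; lra). assert (HB : 0 <= B) by (unfold B; lra).
  set (z := quarters P Q A B (a, c)).
  assert (Hz : forall n, (a <= fst (z n) /\ fst (z n) + A / 2 ^ n <= b) /\
                         (c <= snd (z n) /\ snd (z n) + B / 2 ^ n <= d)).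
  { induction n as [|n IH].
    - unfold A, B. simpl. lra.
    - pose proof (quarter_range P Q A B n (z n) HA HB) as Hr.
      change (z (S n)) with (quarter P Q A B n (z n)).
      destruct Hr as [[R1 R2] [R3 R4]]. destruct IH as [[I1 I2] [I3 I4]].
      split; split; eapply Rle_trans; eassumption. }
  assert (Hbig : forall n, dyadic_circulation P Q A B 0 (a, c) / 4 ^ n
                           <= dyadic_circulation P Q A B n (z n)).
  { induction n as [|n IH].
    - change (z 0%nat) with (a, c). rewrite pow_O. right. field.
    - change (z (S n)) with (quarter P Q A B n (z n)). destruct (Hz n) as [[Z1 Z2] [Z3 Z4]].
      eapply Rle_trans; [|apply (quarter_big P Q a b c d); assumption].
      apply (Rmult_le_compat_r (/ 4)) in IH; [|lra].
      eapply Rle_trans; [|exact IH]. right. simpl. field. apply pow_nonzero. lra. }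
  destruct (nested_halving A (fun n => fst (z n))) as [x0 Hx0].
  { intros n. apply (quarter_range P Q A B n (z n) HA HB). } { exact HA. }
  destruct (nested_halving B (fun n => snd (z n))) as [y0 Hy0].
  { intros n. apply (quarter_range P Q A B n (z n) HA HB). } { exact HB. }
  assert (Hx0' : a <= x0 <= b).
  { specialize (Hx0 0%nat). unfold z, A in Hx0. simpl in Hx0. lra. }
  assert (Hy0' : c <= y0 <= d).
  { specialize (Hy0 0%nat). unfold z, B in Hy0. simpl in Hy0. lra. }
  assert (Hall : forall eps, 0 < eps ->
            Rabs (circulation P Q a b c d) <= 2 * eps * (A + B) ^ 2).
  { intros eps Heps.
    destruct (circulation_local P Q a b c d x0 y0 eps H Hx0' Hy0' Heps) as (dl & Hdl & Hloc).
    (* Such an n makes both sides A / 2^n and B / 2^n shorter than [dl]; the + 1 keeps the quotient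
       meaningful for a degenerate rectangle. *)
    destruct (pow_lt_1_zero (1 / 2)) with (y := dl / (A + B + 1)) as [n Hn].
    { rewrite Rabs_pos_eq; lra. } { apply Rdiv_lt_0_compat; lra. }
    specialize (Hn n (le_n n)).
    assert (H2 : 0 < 2 ^ n) by (apply pow_lt; lra).
    assert (E2 : (1 / 2) ^ n = / 2 ^ n).
    { unfold Rdiv. rewrite Rmult_1_l. apply pow_inv. }
    rewrite E2, Rabs_pos_eq in Hn by (apply Rlt_le, Rinv_0_lt_compat; exact H2).
    assert (Hs : (A + B + 1) * / 2 ^ n < dl).
    { apply (Rmult_lt_compat_l (A + B + 1)) in Hn; [|lra].
      replace ((A + B + 1) * (dl / (A + B + 1))) with dl in Hn by (field; lra). exact Hn. }
    assert (Hi : 0 < / 2 ^ n) by (apply Rinv_0_lt_compat; exact H2).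
    specialize (Hz n). specialize (Hx0 n). specialize (Hy0 n). cbv beta in Hx0, Hy0.
    specialize (Hloc (fst (z n)) (snd (z n)) (A / 2 ^ n) (B / 2 ^ n)).
    specialize (Hbig n). unfold dyadic_circulation in Hbig. cbn [fst snd] in Hbig.
    replace (a + A / 2 ^ 0) with b in Hbig by (unfold A; simpl; field).
    replace (c + B / 2 ^ 0) with d in Hbig by (unfold B; simpl; field).
    assert (Hf := Rle_trans _ _ _ Hbig (Hloc ltac:(lra) ltac:(lra) ltac:(lra) ltac:(lra)
       ltac:(unfold Rdiv; nra) ltac:(unfold Rdiv; nra))).
    assert (E4 : 4 ^ n = 2 ^ n * 2 ^ n).
    { rewrite <- Rpow_mult_distr. replace (2 * 2) with 4 by ring. reflexivity. }
    rewrite E4 in Hf.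
    apply (Rmult_le_compat_r (2 ^ n * 2 ^ n)) in Hf; [|nra].
    replace (Rabs (circulation P Q a b c d) / (2 ^ n * 2 ^ n) * (2 ^ n * 2 ^ n))
      with (Rabs (circulation P Q a b c d)) in Hf by (field; lra).
    eapply Rle_trans; [exact Hf|]. right. field. lra. }
  destruct (Req_dec (circulation P Q a b c d) 0) as [E|E]; [exact E|exfalso].
  apply Rabs_pos_lt in E.
  (* This eps makes the bound 2 eps (A + B)^2 at most half of the circulation itself. *)
  pose proof (Hall (Rabs (circulation P Q a b c d) / (4 * ((A + B) ^ 2 + 1)))) as Hf.
  assert (0 <= (A + B) ^ 2) by apply pow2_ge_0.
  assert (Hq : 0 < Rabs (circulation P Q a b c d) / (4 * ((A + B) ^ 2 + 1))).
  { apply Rdiv_lt_0_compat; lra. }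
  specialize (Hf Hq).
  set (q := Rabs (circulation P Q a b c d) / (4 * ((A + B) ^ 2 + 1))) in *.
  assert (Rabs (circulation P Q a b c d) = q * (4 * ((A + B) ^ 2 + 1))).
  { unfold q. field. lra. }
  nra.
Qed.

(** * Cauchy-Riemann equations and the exponential *)

Lemma Cmod_le_abs (z : C) : Cmod z <= Rabs (Re z) + Rabs (Im z).
Proof.
  destruct z as [x y]. simpl. 
  rewrite <- (Rabs_pos_eq (Rabs x + Rabs y)).
  2: { pose proof (Rabs_pos x); pose proof (Rabs_pos y); lra. }
  rewrite <- sqrt_Rsqr_abs. unfold Cmod. simpl. apply sqrt_le_1_alt.
  unfold Rsqr. pose proof (Rabs_pos x). pose proof (Rabs_pos y).
  assert (Rabs x * Rabs x = x * x) by (rewrite <- Rabs_mult; apply Rabs_pos_eq; nra).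
  assert (Rabs y * Rabs y = y * y) by (rewrite <- Rabs_mult; apply Rabs_pos_eq; nra).
  nra.
Qed.

Lemma Rabs_Re_le (z : C) : Rabs (Re z) <= Cmod z.
Proof. eapply Rle_trans; [|apply (Rmax_Cmod z)]. apply Rmax_l. Qed.

Lemma Rabs_Im_le (z : C) : Rabs (Im z) <= Cmod z.
Proof. eapply Rle_trans; [|apply (Rmax_Cmod z)]. apply Rmax_r. Qed.

Lemma cderiv_differentiable_pt_lim (f : C -> C) (x y a b : R) :
  cderiv f (x, y) (a, b) ->
  differentiable_pt_lim (fun u v => Re (f (u, v))) x y a (- b) /\
  differentiable_pt_lim (fun u v => Im (f (u, v))) x y b a.
Proof.
  rewrite cderiv_spec. intros H.
  assert (Hk : forall eps : posreal, exists delta : posreal, forall u v,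
     Rabs (u - x) < delta -> Rabs (v - y) < delta ->
     Cmod (f (u, v) - f (x, y) - ((u, v) - (x, y)) * (a, b))
       <= eps * Rmax (Rabs (u - x)) (Rabs (v - y))).
  (* Real differentiability is measured in the max norm, and |z| is at most twice the larger of |Re
     z| and |Im z|; this accounts for both halvings. *)
  { intros eps. destruct (H (eps / 2)) as [d [Hd HH]].
    { pose proof (cond_pos eps). lra. }
    exists (mkposreal (d / 2) ltac:(lra)). simpl. intros u v Hu Hv.
    pose proof (Cmod_le_abs ((u, v) - (x, y))) as Hm. simpl in Hm.
    change (u + - x) with (u - x) in Hm. change (v + - y) with (v - y) in Hm.
    eapply Rle_trans; [apply HH; lra|].
    pose proof (cond_pos eps).
    pose proof (Rmax_l (Rabs (u - x)) (Rabs (v - y))).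
    pose proof (Rmax_r (Rabs (u - x)) (Rabs (v - y))). nra. }
  split; intros eps; destruct (Hk eps) as [d Hd]; exists d; intros u v Hu Hv;
    (eapply Rle_trans; [|apply (Hd u v Hu Hv)]).
  - eapply Rle_trans; [|apply Rabs_Re_le]. right. f_equal. unfold Re, Im; simpl; ring.
  - eapply Rle_trans; [|apply Rabs_Im_le]. right. f_equal. unfold Re, Im; simpl; ring.
Qed.

Lemma cauchy_riemann (f : C -> C) (x y a b : R) :
  differentiable_pt_lim (fun u v => Re (f (u, v))) x y a (- b) ->
  differentiable_pt_lim (fun u v => Im (f (u, v))) x y b a ->
  cderiv f (x, y) (a, b).
Proof.
  intros H1 H2. apply cderiv_spec. intros eps Heps.
  assert (He : 0 < eps / 2) by lra.
  destruct (H1 (mkposreal _ He)) as [d1 HH1]. destruct (H2 (mkposreal _ He)) as [d2 HH2].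
  simpl in HH1, HH2.
  exists (Rmin d1 d2). split. { apply Rmin_glb_lt. apply d1. apply d2. }
  intros [u v] Hw.
  pose proof (Rmin_l d1 d2). pose proof (Rmin_r d1 d2).
  pose proof (Rabs_Re_le ((u, v) - (x, y))) as R1.
  pose proof (Rabs_Im_le ((u, v) - (x, y))) as R2. simpl in R1, R2.
  change (u + - x) with (u - x) in R1. change (v + - y) with (v - y) in R2.
  specialize (HH1 u v ltac:(lra) ltac:(lra)). specialize (HH2 u v ltac:(lra) ltac:(lra)).
  assert (Hm : Rmax (Rabs (u - x)) (Rabs (v - y)) <= Cmod ((u, v) - (x, y))).
  { apply Rmax_lub; assumption. }
  apply (Rmult_le_compat_l (eps / 2)) in Hm; [|lra].
  eapply Rle_trans; [apply Cmod_le_abs|].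
  match type of HH1 with Rabs ?t <= _ =>
    replace (Re (f (u, v) - f (x, y) - ((u, v) - (x, y)) * (a, b))) with t by (unfold Re, Im; simpl; ring) end.
  match type of HH2 with Rabs ?t <= _ =>
    replace (Im (f (u, v) - f (x, y) - ((u, v) - (x, y)) * (a, b))) with t by (unfold Re, Im; simpl; ring) end.
  lra.
Qed.

(** * Rules for real differentials in the plane, and the derivative of the exponential *)

Lemma differentiable_pt_lim_fst (x y : R) : differentiable_pt_lim (fun u _ => u) x y 1 0.
Proof.
  intros eps. exists eps. intros u v _ _.
  replace (u - x - _) with 0 by ring. rewrite Rabs_R0.
  apply Rmult_le_pos. apply Rlt_le, eps. eapply Rle_trans; [apply Rabs_pos | apply Rmax_l].
Qed.

Lemma differentiable_pt_lim_snd (x y : R) : differentiable_pt_lim (fun _ v => v) x y 0 1.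
Proof.
  intros eps. exists eps. intros u v _ _.
  replace (v - y - _) with 0 by ring. rewrite Rabs_R0.
  apply Rmult_le_pos. apply Rlt_le, eps. eapply Rle_trans; [apply Rabs_pos | apply Rmax_l].
Qed.

Lemma differentiable_pt_lim_comp_1 (f : R -> R) (g : R -> R -> R) (x y l gx gy : R) :
  derivable_pt_lim f (g x y) l -> differentiable_pt_lim g x y gx gy ->
  differentiable_pt_lim (fun u v => f (g u v)) x y (l * gx) (l * gy).
Proof.
  intros Hf Hg.
  pose proof (differentiable_pt_lim_comp (fun u _ => f u) g g x y l 0 gx gy gx gy
    (differentiable_pt_lim_proj1_0 _ _ _ _ Hf) Hg Hg) as H.
  rewrite !Rmult_0_l, !Rplus_0_r in H. exact H.
Qed.

Lemma differentiable_pt_lim_mult (f g : R -> R -> R) (x y fx fy gx gy : R) :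
  differentiable_pt_lim f x y fx fy -> differentiable_pt_lim g x y gx gy ->
  differentiable_pt_lim (fun u v => f u v * g u v) x y
    (fx * g x y + f x y * gx) (fy * g x y + f x y * gy).
Proof.
  intros Hf Hg.
  apply filterdiff_differentiable_pt_lim in Hf.
  apply filterdiff_differentiable_pt_lim in Hg.
  apply filterdiff_differentiable_pt_lim.
  eapply filterdiff_ext_lin.
  - apply (filterdiff_mult_fct (K := R_AbsRing) _ _ _ _ _ Rmult_comm Hf Hg).
  - intros [u v]. unfold plus, mult; simpl. ring.
Qed.

Lemma differentiable_pt_lim_plus (f g : R -> R -> R) (x y fx fy gx gy : R) :
  differentiable_pt_lim f x y fx fy -> differentiable_pt_lim g x y gx gy ->
  differentiable_pt_lim (fun u v => f u v + g u v) x y (fx + gx) (fy + gy).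
Proof.
  intros Hf Hg.
  apply filterdiff_differentiable_pt_lim in Hf.
  apply filterdiff_differentiable_pt_lim in Hg.
  apply filterdiff_differentiable_pt_lim.
  eapply filterdiff_ext_lin.
  - apply (filterdiff_plus_fct (K := R_AbsRing) (V := R_NormedModule) _ _ _ _ Hf Hg).
  - intros [u v]. unfold plus, mult; simpl. ring.
Qed.

Lemma differentiable_pt_lim_eq (f : R -> R -> R) (x y a b a' b' : R) :
  a = a' -> b = b' -> differentiable_pt_lim f x y a b -> differentiable_pt_lim f x y a' b'.
Proof. intros -> ->. trivial. Qed.

Lemma cderiv_Cexp (z : C) : cderiv Cexp z (Cexp z).
Proof.
  destruct z as [x y].
  assert (He : differentiable_pt_lim (fun u _ => exp u) x y (exp x) 0).
  { apply differentiable_pt_lim_proj1_0. apply derivable_pt_lim_exp. }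
  assert (Hc : differentiable_pt_lim (fun _ v => cos v) x y (- sin y * 0) (- sin y * 1)).
  { apply (differentiable_pt_lim_comp_1 cos (fun _ v => v)).
    apply derivable_pt_lim_cos. apply differentiable_pt_lim_snd. }
  assert (Hs : differentiable_pt_lim (fun _ v => sin v) x y (cos y * 0) (cos y * 1)).
  { apply (differentiable_pt_lim_comp_1 sin (fun _ v => v)).
    apply derivable_pt_lim_sin. apply differentiable_pt_lim_snd. }
  unfold Cexp at 2. cbn [Re Im fst snd].
  apply cauchy_riemann; simpl.
  - refine (differentiable_pt_lim_eq _ _ _ _ _ _ _ _ _ (differentiable_pt_lim_mult _ _ _ _ _ _ _ _ He Hc)); ring.
  - refine (differentiable_pt_lim_eq _ _ _ _ _ _ _ _ _ (differentiable_pt_lim_mult _ _ _ _ _ _ _ _ He Hs)); ring.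
Qed.

Lemma Cmod_Cexp (z : C) : Cmod (Cexp z) = exp (Re z).
Proof.
  unfold Cmod, Cexp. simpl.
  replace (_ + _) with (exp (Re z) * exp (Re z)).
  - apply sqrt_square. apply Rlt_le, exp_pos.
  - pose proof (sin2_cos2 (Im z)) as H. unfold Rsqr in H.
    transitivity (exp (Re z) * exp (Re z) * (sin (Im z) * sin (Im z) + cos (Im z) * cos (Im z))).
    + rewrite H. ring.
    + ring.
Qed.

(** * Mean value property and the derivative at the origin *)

Lemma Cmod_0_iff (z : C) : Cmod z = 0 <-> z = RtoC 0.
Proof. split. apply Cmod_eq_0. intros ->. apply Cmod_0. Qed.

Lemma Cexp_polar_Cmod (r t : R) : 0 < r -> Cmod (Cexp (ln r, t)) = r.
Proof. intros Hr. rewrite Cmod_Cexp. simpl. apply exp_ln. exact Hr. Qed.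

(** With F(s + i t) = f(exp(s + i t)), the form Im F ds + Re F dt is the imaginary part of F d(s + i
    t), so the Cauchy-Riemann equations close it. The half-plane s < 0 is mapped onto the punctured
    disc. *)
Lemma pullback_closed_form (f : C -> C) (x y : R) :
  x < 0 -> (forall z, 0 < Cmod z < 1 -> exists l, cderiv f z l) ->
  exists px k qy,
    differentiable_pt_lim (fun s t => Im (f (Cexp (s, t)))) x y px k /\
    differentiable_pt_lim (fun s t => Re (f (Cexp (s, t)))) x y k qy.
Proof.
  intros Hx H.
  destruct (H (Cexp (x, y))) as [l Hl].
  { rewrite Cmod_Cexp. simpl. split. apply exp_pos. rewrite <- exp_0. apply exp_increasing. exact Hx. }
  pose proof (cderiv_comp f Cexp (x, y) _ _ Hl (cderiv_Cexp (x, y))) as Hd.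
  destruct (l * Cexp (x, y))%C as [a b].
  destruct (cderiv_differentiable_pt_lim (fun w => f (Cexp w)) x y a b Hd) as [H1 H2].
  exists b, a, (- b). split; assumption.
Qed.

Lemma circle_continuous (f : C -> C) (r t : R) :
  0 < r < 1 -> (forall z, 0 < Cmod z < 1 -> exists l, cderiv f z l) ->
  continuous (fun t => Re (f (Cexp (ln r, t)))) t.
Proof.
  intros Hr H.
  destruct (pullback_closed_form f (ln r) t) as (px & k & qy & _ & HQ).
  - rewrite <- ln_1. apply ln_increasing; lra.
  - exact H.
  - exact (differentiable_pt_lim_continuous_2 _ _ _ _ _ HQ).
Qed.

(** On the logarithmic rectangle from ln s to ln r and 0 to 2 pi the horizontal edges cancel by
    periodicity, so the circle integral is the same for all radii; letting s tend to 0 uses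
    continuity at the origin. Assuming derivatives only off the origin allows f(z)/z as input. *)
Lemma mean_value (f : C -> C) (r : R) :
  0 < r < 1 -> (forall z, 0 < Cmod z < 1 -> exists l, cderiv f z l) ->
  ccont f (RtoC 0) ->
  RInt (fun t => Re (f (Cexp (ln r, t)))) 0 (2 * PI) = 2 * PI * Re (f (RtoC 0)).
Proof.
  intros Hr H Hc. pose proof PI_RGT_0 as HPI.
  assert (Hln : forall s, 0 < s < 1 -> ln s < 0).
  { intros s Hs. rewrite <- ln_1. apply ln_increasing; lra. }
  assert (Hinv : forall s, 0 < s <= r ->
    RInt (fun t => Re (f (Cexp (ln r, t)))) 0 (2 * PI) =
    RInt (fun t => Re (f (Cexp (ln s, t)))) 0 (2 * PI)).
  { intros s Hs.
    assert (C0 : circulation (fun x y => Im (f (Cexp (x, y)))) (fun x y => Re (f (Cexp (x, y))))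
              (ln s) (ln r) 0 (2 * PI) = 0).
    { apply circulation_closed. apply ln_le; lra. lra.
      intros x y Hx Hy. apply pullback_closed_form. pose proof (Hln r Hr). lra. exact H. }
    unfold circulation in C0.
    assert (E : forall x, Im (f (Cexp (x, 2 * PI))) = Im (f (Cexp (x, 0)))).
    { intros x. unfold Cexp. cbn [Re Im fst snd]. rewrite cos_2PI, sin_2PI, cos_0, sin_0. reflexivity. }
    rewrite (RInt_ext (fun x => Im (f (Cexp (x, 2 * PI)))) (fun x => Im (f (Cexp (x, 0))))) in C0
      by (intros; apply E).
    lra. }
  assert (Hall : forall eps, 0 < eps ->
     Rabs (RInt (fun t => Re (f (Cexp (ln r, t)))) 0 (2 * PI) - 2 * PI * Re (f (RtoC 0)))
       <= eps * (2 * PI)).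
  { intros eps Heps. destruct (Hc eps Heps) as [d [Hd HH]].
    set (s := Rmin r (d / 2)).
    assert (Hs : 0 < s) by (apply Rmin_glb_lt; lra).
    pose proof (Rmin_l r (d / 2)). pose proof (Rmin_r r (d / 2)). fold s in H0, H1.
    rewrite (Hinv s) by lra.
    pose proof (RInt_near_const (fun t => Re (f (Cexp (ln s, t)))) 0 (2 * PI) (Re (f (RtoC 0))) eps) as B.
    replace (2 * PI - 0) with (2 * PI) in B by ring.
    rewrite (Rmult_comm (2 * PI)). apply B. lra.
    - intros t _. apply circle_continuous. lra. exact H.
    - intros t _. replace (Re (f (Cexp (ln s, t))) - Re (f (RtoC 0)))
        with (Re (f (Cexp (ln s, t)) - f (RtoC 0))) by reflexivity.
      eapply Rle_trans; [apply Rabs_Re_le|]. apply Rlt_le, HH.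
      replace (Cexp (ln s, t) - RtoC 0)%C with (Cexp (ln s, t)) by ring.
      rewrite Cexp_polar_Cmod; lra. }
  set (D := RInt _ _ _ - _) in Hall. 
  assert (HD : D = 0); [|unfold D in HD; lra].
  destruct (Req_dec D 0) as [E|E]; [exact E|exfalso].
  apply Rabs_pos_lt in E.
  specialize (Hall (Rabs D / (4 * PI))). 
  assert (0 < Rabs D / (4 * PI)) by (apply Rdiv_lt_0_compat; lra).
  specialize (Hall H0). replace (Rabs D / (4 * PI) * (2 * PI)) with (Rabs D / 2) in Hall by (field; lra).
  lra.
Qed.

(** Turns a bound on a modulus into a bound on the real part of a rotated value, to which real
    integrals and real derivatives apply. *)
Lemma rotate_to_Cmod (l : C) : exists u, Cmod u = 1 /\ (u * l)%C = RtoC (Cmod l).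
Proof.
  destruct (Req_dec (Cmod l) 0) as [E|E].
  - exists (RtoC 1). split. apply Cmod_1. apply Cmod_0_iff in E. subst. rewrite Cmod_0. ring.
  - exists (Cconj l / RtoC (Cmod l))%C.
    assert (E' : RtoC (Cmod l) <> RtoC 0) by (intros X; apply E; injection X; trivial).
    assert (Hp : Cmod (Cconj l) = Cmod l) by apply Cmod_conj.
    split.
    + rewrite Cmod_div by exact E'. rewrite Hp, Cmod_R, Rabs_pos_eq by apply Cmod_ge_0. field. exact E.
    + replace (Cconj l / RtoC (Cmod l) * l)%C with (l * Cconj l / RtoC (Cmod l))%C by (field; exact E').
      rewrite <- Cmod2_conj. simpl. rewrite Rmult_1_r, RtoC_mult. field. exact E'.
Qed.

Lemma schwarz_derivative (f : C -> C) (l : C) :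
  (forall z, Cmod z < 1 -> exists l, cderiv f z l) ->
  (forall z, Cmod z < 1 -> Cmod (f z) <= 1) ->
  f (RtoC 0) = RtoC 0 -> cderiv f (RtoC 0) l -> Cmod l <= 1.
Proof.
  intros Hd Hb H0 Hl.
  destruct (rotate_to_Cmod l) as [u [Hu Eu]].
  (* The mean value of u f(z)/z, whose value at 0 is u l = |l|, is at most 1/r on |z| = r. *)
  set (g := fun z => if Req_EM_T (Cmod z) 0 then (u * l)%C else (u * (f z / z))%C).
  assert (Hg : forall z, z <> RtoC 0 -> g z = (u * (f z / z))%C).
  { intros z Hz. unfold g. destruct Req_EM_T as [E|E]; [|reflexivity].
    apply Cmod_0_iff in E. contradiction. }
  assert (Hg0 : g (RtoC 0) = RtoC (Cmod l)).
  { unfold g. destruct Req_EM_T as [E|E]. exact Eu. exfalso. apply E, Cmod_0. }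
  assert (Hgd : forall z, 0 < Cmod z < 1 -> exists l, cderiv g z l).
  { intros z Hz. destruct (Hd z) as [m Hm]. apply Hz.
    assert (z <> RtoC 0) by (apply Cmod_gt_0; apply Hz).
    eexists. eapply (cderiv_ext_ball (fun w => u * (f w / w))%C g z _ (Cmod z)). apply Hz.
    - intros w Hw. symmetry. apply Hg. intros ->.
      replace (RtoC 0 - z)%C with (- z)%C in Hw by ring. rewrite Cmod_opp in Hw. lra.
    - apply cderiv_mult. apply cderiv_const. apply cderiv_div. assumption. exact Hm. apply cderiv_id. }
  assert (Hgc : ccont g (RtoC 0)).
  { intros eps Heps. pose proof (proj1 (cderiv_spec _ _ _) Hl (eps / 2)) as [d [Hdp HH]]. lra.
    exists d. split. exact Hdp. intros w Hw.
    destruct (Req_dec (Cmod w) 0) as [E|E].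
    - apply Cmod_0_iff in E. subst w. 
      replace (g 0 - g 0)%C with (RtoC 0) by ring. rewrite Cmod_0. exact Heps.
    - assert (E' : w <> RtoC 0) by (intros X; apply E, Cmod_0_iff, X).
      rewrite Hg0, <- Eu, Hg by exact E'. specialize (HH w Hw). rewrite H0 in HH.
      replace (u * (f w / w) - u * l)%C with (u * ((f w - RtoC 0 - (w - RtoC 0) * l) / w))%C by (field; exact E').
      rewrite Cmod_mult, Hu, Cmod_div by exact E'.
      replace (w - RtoC 0)%C with w in HH at 2 by ring.
      pose proof (Cmod_ge_0 w).
      apply (Rle_lt_trans _ (eps / 2)); [|lra]. rewrite Rmult_1_l. 
      apply Rle_div_l. lra. exact HH. }
  assert (Hr : forall r, 0 < r < 1 -> Cmod l <= / r).
  { intros r Hr. pose proof (mean_value g r Hr Hgd Hgc) as M. rewrite Hg0 in M.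
    assert (B : Rabs (RInt (fun t => Re (g (Cexp (ln r, t)))) 0 (2 * PI)) <= (2 * PI - 0) * / r).
    { pose proof PI_RGT_0. apply abs_RInt_le_const. lra.
      - apply ex_RInt_continuous_R. lra. intros t _. apply circle_continuous; assumption.
      - intros t _. eapply Rle_trans; [apply Rabs_Re_le|].
        assert (E := Cexp_polar_Cmod r t (proj1 Hr)).
        assert (Cexp (ln r, t) <> RtoC 0) by (apply Cmod_gt_0; lra).
        rewrite Hg by assumption. rewrite Cmod_mult, Hu, Cmod_div, E by assumption.
        rewrite Rmult_1_l. pose proof (Hb (Cexp (ln r, t)) ltac:(lra)) as X.
        apply (Rmult_le_compat_r (/ r)) in X. unfold Rdiv. lra.
        apply Rlt_le, Rinv_0_lt_compat. lra. }
    rewrite M in B. change (Re (RtoC (Cmod l))) with (Cmod l) in B.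
    pose proof PI_RGT_0. pose proof (Cmod_ge_0 l). rewrite Rabs_pos_eq in B by nra.
    rewrite Rminus_0_r in B. apply Rmult_le_reg_l in B; lra. }
  apply Rnot_lt_le. intros Hlt.
  (* The radius with 1/r = (1 + |l|)/2, strictly between 1 and |l| when |l| > 1. *)
  specialize (Hr (2 / (1 + Cmod l))).
  assert (X : 0 < 2 / (1 + Cmod l) < 1).
  { split. apply Rdiv_lt_0_compat; lra. apply Rlt_div_l; lra. }
  specialize (Hr X). rewrite Rinv_div in Hr. lra.
Qed.

(** * The Schwarz lemma *)

Lemma Cmod_sqr (z : C) : Cmod z * Cmod z = Re z * Re z + Im z * Im z.
Proof.
  unfold Cmod. rewrite sqrt_sqrt. unfold Re, Im. ring. nra.
Qed.

Lemma Cmod_lt_1_iff (z : C) : Cmod z < 1 <-> Re z * Re z + Im z * Im z < 1.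
Proof. rewrite <- Cmod_sqr. pose proof (Cmod_ge_0 z). split; intros; nra. Qed.

Definition moebius (b u : C) : C := ((u - b) / (1 - Cconj b * u))%C.

Lemma moebius_denominator (b u : C) : Cmod b < 1 -> Cmod u < 1 -> (1 - Cconj b * u)%C <> RtoC 0.
Proof.
  intros Hb Hu E. 
  pose proof (Cmod_triangle_minus 1 (1 - Cconj b * u)) as H. rewrite E in H.
  rewrite Cmod_1, Cmod_0 in H.
  replace (1 - 0)%C with (Cconj b * u)%C in H.
  - rewrite Cmod_mult, Cmod_conj in H. pose proof (Cmod_ge_0 b). pose proof (Cmod_ge_0 u). nra.
  - transitivity (1 - (1 - Cconj b * u))%C. ring. rewrite E. ring.
Qed.

(** Rests on |1 - conj(b) u|^2 - |u - b|^2 = (1 - |b|^2)(1 - |u|^2), which is positive. *)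
Lemma moebius_lt_1 (b u : C) : Cmod b < 1 -> Cmod u < 1 -> Cmod (moebius b u) < 1.
Proof.
  intros Hb Hu. pose proof (moebius_denominator b u Hb Hu) as Hn.
  unfold moebius. rewrite Cmod_div by exact Hn.
  apply Cmod_gt_0 in Hn. apply Rlt_div_l. exact Hn. rewrite Rmult_1_l.
  pose proof (Cmod_sqr (u - b)) as E1. pose proof (Cmod_sqr (1 - Cconj b * u)) as E2.
  apply Cmod_lt_1_iff in Hb. apply Cmod_lt_1_iff in Hu.
  pose proof (Cmod_ge_0 (u - b)).
  destruct b as [b1 b2]. destruct u as [u1 u2]. simpl in E1, E2, Hb, Hu.
  set (m := Cmod ((u1, u2) - (b1, b2))) in *.
  set (n := Cmod (1 - Cconj (b1, b2) * (u1, u2))) in *.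
  assert (n * n - m * m = (1 - (b1 * b1 + b2 * b2)) * (1 - (u1 * u1 + u2 * u2))).
  { rewrite E1, E2. ring. }
  assert (0 < (1 - (b1 * b1 + b2 * b2)) * (1 - (u1 * u1 + u2 * u2))).
  { apply Rmult_lt_0_compat; lra. }
  nra.
Qed.

Lemma cderiv_moebius (b u : C) : Cmod b < 1 -> Cmod u < 1 ->
  cderiv (moebius b) u
    ((1 - Cconj b * b) / ((1 - Cconj b * u) * (1 - Cconj b * u)))%C.
Proof.
  intros Hb Hu. pose proof (moebius_denominator b u Hb Hu) as Hn.
  refine (cderiv_eq _ _ _ _ _ (cderiv_div (fun u => u - b)%C (fun u => 1 - Cconj b * u)%C u _ _ Hn
    (cderiv_minus _ _ _ _ _ (cderiv_id u) (cderiv_const b u))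
    (cderiv_minus _ _ _ _ _ (cderiv_const _ u)
       (cderiv_mult _ _ _ _ _ (cderiv_const (Cconj b) u) (cderiv_id u))))).
  field. exact Hn.
Qed.

Lemma Cconj_mult_self (z : C) : (Cconj z * z)%C = RtoC (Cmod z * Cmod z).
Proof.
  rewrite Cmod_sqr. destruct z as [x y]. unfold Cconj, Cmult, RtoC, Re, Im. simpl. f_equal; ring.
Qed.

(** [moebius (- a)] sends 0 to a and [moebius (w a)] sends w a to 0, so w composed with both fixes
    0. Its derivative there is l (1 - |a|^2) / (1 - |w a|^2), to which [schwarz_derivative]
    applies. *)
Lemma schwarz_pick (w : C -> C) (a l : C) :
  (forall z, Cmod z < 1 -> exists l, cderiv w z l) ->
  (forall z, Cmod z < 1 -> Cmod (w z) < 1) ->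
  Cmod a < 1 -> cderiv w a l ->
  Cmod l * (1 - Cmod a * Cmod a) <= 1 - Cmod (w a) * Cmod (w a).
Proof.
  intros Hd Hb Ha Hl.
  assert (Ha' : Cmod (- a) < 1) by (rewrite Cmod_opp; exact Ha).
  assert (H0 : Cmod (RtoC 0) < 1) by (rewrite Cmod_0; lra).
  assert (E0 : moebius (- a) 0 = a).
  { unfold moebius. field. }
  set (f := fun z => moebius (w a) (w (moebius (- a) z))).
  pose proof (Hb a Ha) as Hwa.
  assert (Hmd : forall z, Cmod z < 1 -> exists m, cderiv f z m).
  { intros z Hz. pose proof (moebius_lt_1 _ _ Ha' Hz) as Hm.
    destruct (Hd _ Hm) as [m Hwm]. eexists.
    apply (cderiv_comp (moebius (w a)) (fun z => w (moebius (- a) z))).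
    - apply cderiv_moebius. exact Hwa. apply Hb. exact Hm.
    - apply (cderiv_comp w (moebius (- a))). exact Hwm. apply cderiv_moebius; assumption. }
  assert (Hn : (1 - Cconj (w a) * w a)%C <> RtoC 0) by (apply moebius_denominator; exact Hwa).
  pose proof (Cmod_ge_0 (w a)). pose proof (Cmod_ge_0 a).
  assert (B : 0 < 1 - Cmod (w a) * Cmod (w a)) by nra.
  assert (A' : 0 < 1 - Cmod a * Cmod a) by nra.
  assert (N : RtoC (1 - Cmod (w a) * Cmod (w a)) <> RtoC 0) by (intros X; injection X; lra).
  assert (Hf : cderiv f (RtoC 0)
            (l * RtoC (1 - Cmod a * Cmod a) / RtoC (1 - Cmod (w a) * Cmod (w a)))%C).
  { refine (cderiv_eq _ _ _ _ _ (cderiv_comp (moebius (w a)) (fun z => w (moebius (- a) z)) _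
      ((1 - Cconj (w a) * w a) / ((1 - Cconj (w a) * w a) * (1 - Cconj (w a) * w a)))%C _ _
      (cderiv_comp w (moebius (- a)) _ l _ _ (cderiv_moebius _ _ Ha' H0)))).
    - rewrite !RtoC_minus, <- !Cconj_mult_self.
      replace (Cconj (- a) * (- a))%C with (Cconj a * a)%C.
      + field. exact Hn.
      + destruct a. unfold Cconj, Cmult, Copp. simpl. f_equal; ring.
    - rewrite E0. apply cderiv_moebius; exact Hwa.
    - rewrite E0. exact Hl. }
  assert (S := fun X Y => schwarz_derivative f _ Hmd X Y Hf).
  rewrite Cmod_div, Cmod_mult, !Cmod_R, !Rabs_pos_eq in S by (try exact N; lra).
  apply Rle_div_l in S; [lra|exact B| |].
  - intros z Hz. apply Rlt_le. apply moebius_lt_1. exact Hwa. apply Hb. apply moebius_lt_1; assumption.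
  - unfold f. rewrite E0. unfold moebius. unfold Cminus at 1. rewrite Cplus_opp_r. unfold Cdiv. ring.
Qed.

(** * Integration of derivative bounds along rays *)

Lemma nonincreasing_of_derivative (f : R -> R) (a b : R) :
  a <= b ->
  (forall t, a <= t <= b -> continuous f t) ->
  (forall t, a < t < b -> exists d, is_derive f t d /\ d <= 0) ->
  f b <= f a.
Proof.
  intros Hab Hc Hd.
  (* The mean value point may be an endpoint, where the sign of [Derive f] is not controlled; the
     minimum with 0 is nonpositive everywhere and agrees with the derivative inside. *)
  destruct (MVT_gen f a b (fun t => Rmin 0 (Derive f t))) as [c [_ E]].
  - rewrite Rmin_left, Rmax_right by lra. intros t Ht.
    destruct (Hd t Ht) as [d [H1 H2]].
    rewrite (is_derive_unique _ _ _ H1), Rmin_right by exact H2. exact H1.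
  - rewrite Rmin_left, Rmax_right by lra. intros t Ht.
    apply continuity_pt_filterlim. apply Hc. exact Ht.
  - pose proof (Rmin_l 0 (Derive f c)). nra.
Qed.

Lemma is_derive_along_ray (f : C -> C) (u e l : C) (t : R) :
  cderiv f (RtoC t * e)%C l ->
  is_derive (fun s => Re (u * f (RtoC s * e)%C)%C) t (Re (u * (l * e))%C).
Proof.
  intros H.
  assert (H1 : cderiv (fun w => w * e)%C (t, 0) e).
  { refine (cderiv_eq _ _ _ _ _ (cderiv_mult _ _ _ _ _ (cderiv_id _) (cderiv_const e _))). ring. }
  assert (H2 : cderiv (fun w => u * f (w * e))%C (t, 0) (u * (l * e))%C).
  { refine (cderiv_eq _ _ _ _ _ (cderiv_mult _ _ _ _ _ (cderiv_const u _)
      (cderiv_comp f (fun w => w * e)%C (t, 0) l _ H H1))). ring. }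
  destruct (u * (l * e))%C as [a b]. cbn [Re fst].
  destruct (cderiv_differentiable_pt_lim _ _ _ _ _ H2) as [H3 _].
  apply is_derive_Reals.
  pose proof (derivable_pt_lim_comp_2d _ (fun s => s) (fun _ => 0) t a (- b) 1 0 H3
    (derivable_pt_lim_id t) (derivable_pt_lim_const 0 t)) as H4.
  replace (a * 1 + - b * 0) with a in H4 by ring. exact H4.
Qed.

Lemma Cmod_ray (t : R) (e : C) : 0 <= t -> Cmod e = 1 -> Cmod (RtoC t * e) = t.
Proof. intros Ht He. rewrite Cmod_mult, He, Cmod_R, Rabs_pos_eq; lra. Qed.

Lemma polar_form (z : C) : exists e, Cmod e = 1 /\ z = (RtoC (Cmod z) * e)%C.
Proof.
  destruct (rotate_to_Cmod z) as [u [Hu E]].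
  exists (Cconj u). split.
  - rewrite Cmod_conj. exact Hu.
  - rewrite <- E. replace (u * z * Cconj u)%C with (Cconj u * u * z)%C by ring.
    rewrite Cconj_mult_self, Hu. rewrite Rmult_1_r. ring.
Qed.

Lemma schwarz (w : C -> C) (z : C) :
  (forall z, Cmod z < 1 -> exists l, cderiv w z l) ->
  (forall z, Cmod z < 1 -> Cmod (w z) < 1) ->
  w (RtoC 0) = RtoC 0 -> Cmod z < 1 -> Cmod (w z) <= Cmod z.
Proof.
  intros Hd Hb H0 Hz.
  destruct (polar_form z) as [e [He Ez]].
  destruct (rotate_to_Cmod (w z)) as [u [Hu Eu]].
  set (r := Cmod z) in *. assert (Hr : 0 <= r) by apply Cmod_ge_0.
  set (x := fun t => Re (u * w (RtoC t * e)%C)%C).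
  assert (Hx : forall t, 0 <= t <= r -> x t * x t <= Cmod (w (RtoC t * e)%C) * Cmod (w (RtoC t * e)%C) /\ x t < 1).
  { intros t Ht. pose proof (Rabs_Re_le (u * w (RtoC t * e)%C)%C) as B. fold (x t) in B.
    rewrite Cmod_mult, Hu in B. pose proof (Hb (RtoC t * e)%C) as B'.
    rewrite Cmod_ray in B' by lra. specialize (B' ltac:(lra)).
    apply Rabs_le_between in B. split; nra. }
  (* Taking real parts only loses: x' is at most |l| and x^2 at most |w|^2, so the Schwarz-Pick
     inequality passes to x. *)
  assert (Hxd : forall t, 0 <= t <= r -> exists d, is_derive x t d /\ d * (1 - t * t) <= 1 - x t * x t).
  { intros t Ht. assert (Hm : Cmod (RtoC t * e) = t) by (apply Cmod_ray; lra).
    destruct (Hd (RtoC t * e)%C) as [l Hl]. lra.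
    exists (Re (u * (l * e))%C). split. apply is_derive_along_ray. exact Hl.
    pose proof (schwarz_pick w (RtoC t * e)%C l Hd Hb ltac:(lra) Hl) as S. rewrite Hm in S.
    pose proof (Rabs_Re_le (u * (l * e))) as B. rewrite !Cmod_mult, Hu, He in B.
    apply Rabs_le_between in B. destruct (Hx t Ht) as [B' _].
    assert (0 < 1 - t * t) by nra. nra. }
  (* x' (1 - t^2) <= 1 - x^2, so artanh x - artanh t is nonincreasing. *)
  assert (N := nonincreasing_of_derivative (fun t => (1 + x t) / (1 - x t) * ((1 - t) / (1 + t))) 0 r Hr).
  assert (X0 : x 0 = 0).
  { unfold x. rewrite Cmult_0_l, H0, Cmult_0_r. reflexivity. }
  assert (Xr : x r = Cmod (w z)).
  { unfold x. rewrite <- Ez, Eu. reflexivity. }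
  (* The product is exp(2 (artanh x - artanh t)), so no logarithm has to be differentiated. Its
     value 1 at t = 0 bounds the value at r, which amounts to x r <= r. *)
  assert (D : forall t, 0 <= t <= r -> exists d,
     is_derive (fun t => (1 + x t) / (1 - x t) * ((1 - t) / (1 + t))) t d /\ d <= 0).
  { intros t Ht. destruct (Hxd t Ht) as [d [H1 H2]]. destruct (Hx t Ht) as [_ H3].
    exists (2 * (d * (1 - t * t) - (1 - x t * x t)) / ((1 - x t) ^ 2 * (1 + t) ^ 2)).
    split.
    - auto_derive.
      + repeat split; try (exists d; exact H1); lra.
      + replace (Derive (fun t => x t) t) with d by (symmetry; apply is_derive_unique, H1).
        field. lra.
    - apply Rle_div_l.
      + assert (0 < (1 - x t) ^ 2) by (apply pow_lt; lra).
        assert (0 < (1 + t) ^ 2) by (apply pow_lt; lra). nra.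
      + lra. }
  assert (F : (1 + x r) / (1 - x r) * ((1 - r) / (1 + r)) <= 1).
  { eapply Rle_trans. apply N.
    - intros t Ht. destruct (D t Ht) as [d [H1 _]].
      apply (ex_derive_continuous (K := R_AbsRing) (V := R_NormedModule)). exists d. exact H1.
    - intros t Ht. apply D. lra.
    - rewrite X0. right. field. }
  destruct (Hx r ltac:(lra)) as [_ H3].
  replace ((1 + x r) / (1 - x r) * ((1 - r) / (1 + r))) with (((1 + x r) * (1 - r)) / ((1 - x r) * (1 + r))) in F by (field; lra).
  apply Rle_div_l in F. 2: { apply Rmult_lt_0_compat; lra. }
  rewrite <- Xr. nra.
Qed.

(** * The reciprocal of p *)

(** The subordination hypothesis with the leading 1 removed, stated for any derivative l. At a zero
    of p the left side is 0 by the convention x / 0 = 0. *)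
Definition car_equation (beta : R) (p w : C -> C) : Prop :=
  forall z l, Cmod z < 1 -> cderiv p z l ->
    (RtoC beta * (z * l / p z ^ 2))%C = (4 * w z / 3 + 2 * w z ^ 2 / 3)%C.

(** Since (1/p)' = - p'/p^2, the equation says that t times the derivative of Re (u / p(t e)) is -
    Re (u (4 w/3 + 2 w^2/3)) / beta. A bound t (c1 + c2 t) on this loses its factor t and integrates
    from 0 to r. The free u and constants serve both a modulus bound and a real-part bound; zeros
    are excluded only on the segment, so the estimate applies before a first zero. *)
Lemma reciprocal_growth (beta : R) (p w : C -> C) (u e : C) (r c1 c2 : R) :
  beta <> 0 -> (forall z, Cmod z < 1 -> exists l, cderiv p z l) ->
  p (RtoC 0) = RtoC 1 -> car_equation beta p w ->
  Cmod e = 1 -> 0 <= r < 1 ->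
  (forall t, 0 <= t <= r -> p (RtoC t * e)%C <> RtoC 0) ->
  (forall t, 0 < t < r ->
     - Re (u * (4 * w (RtoC t * e) / 3 + 2 * w (RtoC t * e) ^ 2 / 3))%C / beta <= t * (c1 + c2 * t)) ->
  Re (u * / p (RtoC r * e))%C - Re u <= c1 * r + c2 * r ^ 2 / 2.
Proof.
  intros Hbeta Hp Hp0 Heq He Hr Hnz HG.
  assert (D : forall t, 0 <= t <= r -> exists l, cderiv p (RtoC t * e)%C l /\
    is_derive (fun t => Re (u * / p (RtoC t * e))%C - (c1 * t + c2 * t ^ 2 / 2)) t
      (Re (u * (- / (p (RtoC t * e) * p (RtoC t * e)) * l * e))%C - (c1 + c2 * t))).
  { intros t Ht. destruct (Hp (RtoC t * e)%C) as [l Hl].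
    { rewrite Cmod_ray; lra. }
    exists l. split. exact Hl.
    apply (is_derive_minus (K := R_AbsRing) (V := R_NormedModule)).
    - apply (is_derive_along_ray (fun z => / p z)%C).
      apply cderiv_inv. apply Hnz. exact Ht. exact Hl.
    - auto_derive. trivial. field. }
  assert (N : Re (u * / p (RtoC r * e))%C - (c1 * r + c2 * r ^ 2 / 2) <= Re u).
  { replace (Re u) with (Re (u * / p (RtoC 0 * e))%C - (c1 * 0 + c2 * 0 ^ 2 / 2)).
    2: { rewrite Cmult_0_l, Hp0. replace (u * / 1)%C with u by field. field. }
    apply (nonincreasing_of_derivative
      (fun t => Re (u * / p (RtoC t * e))%C - (c1 * t + c2 * t ^ 2 / 2)) 0 r (proj1 Hr)).
    - intros t Ht. destruct (D t Ht) as [l [_ H1]].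
      apply (ex_derive_continuous (K := R_AbsRing) (V := R_NormedModule)). eexists. exact H1.
    - intros t Ht. destruct (D t ltac:(lra)) as [l [H1 H2]].
      eexists. split. exact H2. specialize (HG t Ht).
      specialize (Heq (RtoC t * e)%C l ltac:(rewrite Cmod_ray; lra) H1).
      specialize (Hnz t ltac:(lra)).
      rewrite <- Heq in HG.
      (* Re a is the derivative of Re (u / p) along the ray; in these terms [HG] bounds t Re a. *)
      match goal with |- Re ?a - _ <= 0 =>
        replace (Re (u * (RtoC beta * (RtoC t * e * l / p (RtoC t * e) ^ 2)))%C)
          with (- (beta * (t * Re a))) in HG end.
      + apply (Rmult_le_reg_l t). lra.
        match type of HG with - - (beta * ?X) / _ <= _ =>
          replace (- - (beta * X) / beta) with X in HG by (field; exact Hbeta) end.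
        lra.
      + rewrite <- !re_scal_l, <- re_opp. f_equal. field. exact Hnz. }
  lra.
Qed.

Lemma Cmod_car (w : C) (t : R) :
  Cmod w <= t -> Cmod (4 * w / 3 + 2 * w ^ 2 / 3) <= t * (4 / 3 + 2 / 3 * t).
Proof.
  intros Hw. pose proof (Cmod_ge_0 w).
  replace (4 * w / 3 + 2 * w ^ 2 / 3)%C with (RtoC (4 / 3) * w + RtoC (2 / 3) * (w * w))%C
    by (rewrite !RtoC_div by lra; field).
  eapply Rle_trans; [apply Cmod_triangle|].
  rewrite !Cmod_mult, !Cmod_R, !Rabs_pos_eq by lra. nra.
Qed.

(** Put x = Re w, so that Re (w^2) = 2 x^2 - |w|^2. Right side minus left side is 4/3 ((x + t)(1 -
    t) + (x + t/2)^2) + 2/3 (t^2 - |w|^2), a sum of nonnegative terms. *)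
Lemma Re_car (w : C) (t : R) :
  Cmod w <= t <= 1 -> - Re (4 * w / 3 + 2 * w ^ 2 / 3)%C <= t * (4 / 3 + - (1 / 3) * t).
Proof.
  intros Hw.
  replace (4 * w / 3 + 2 * w ^ 2 / 3)%C with (RtoC (4 / 3) * w + RtoC (2 / 3) * (w * w))%C
    by (rewrite !RtoC_div by lra; field).
  pose proof (Cmod_sqr w) as E. pose proof (Cmod_ge_0 w).
  pose proof (Rabs_Re_le w) as B. apply Rabs_le_between in B.
  destruct w as [x y]. simpl in *.
  set (m := Cmod (x, y)) in *.
  assert (0 <= (x + t) * (1 - t)) by (apply Rmult_le_pos; lra).
  pose proof (pow2_ge_0 (x + t / 2)). 
  assert (m * m <= t * t) by (apply Rmult_le_compat; lra).
  nra.
Qed.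

(** Take for u the rotation that makes 1/p - 1 real and nonnegative at the endpoint; [Cmod_car]
    supplies the two constants of [reciprocal_growth]. *)
Lemma reciprocal_close (beta : R) (p w : C -> C) (e : C) (r : R) :
  beta <> 0 -> (forall z, Cmod z < 1 -> exists l, cderiv p z l) ->
  p (RtoC 0) = RtoC 1 -> car_equation beta p w ->
  (forall z, Cmod z < 1 -> Cmod (w z) <= Cmod z) ->
  Cmod e = 1 -> 0 <= r < 1 ->
  (forall t, 0 <= t <= r -> p (RtoC t * e)%C <> RtoC 0) ->
  Cmod (/ p (RtoC r * e) - 1)%C <= (4 / 3 * r + r ^ 2 / 3) / Rabs beta.
Proof.
  intros Hbeta Hp Hp0 Heq Hw He Hr Hnz.
  destruct (rotate_to_Cmod (/ p (RtoC r * e) - 1)%C%C) as [u [Hu E]].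
  assert (Hb : 0 < Rabs beta) by (apply Rabs_pos_lt; exact Hbeta).
  pose proof (reciprocal_growth beta p w u e r (4 / 3 / Rabs beta) (2 / 3 / Rabs beta)
    Hbeta Hp Hp0 Heq He Hr Hnz) as G.
  replace (Cmod (/ p (RtoC r * e) - 1)%C) with (Re (u * / p (RtoC r * e))%C - Re u).
  - eapply Rle_trans; [apply G|].
    + intros t Ht.
      pose proof (Hw (RtoC t * e)%C) as W. rewrite Cmod_ray in W by lra.
      specialize (W ltac:(lra)). apply Cmod_car in W.
      set (g := (4 * w (RtoC t * e) / 3 + 2 * w (RtoC t * e) ^ 2 / 3)%C) in *.
      pose proof (Rabs_Re_le (u * g)) as B. rewrite Cmod_mult, Hu, Rmult_1_l in B.
      eapply Rle_trans; [apply Rle_abs|].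
      rewrite Rabs_div, Rabs_Ropp by exact Hbeta.
      apply Rle_div_l. exact Hb.
      replace (t * (4 / 3 / Rabs beta + 2 / 3 / Rabs beta * t) * Rabs beta)
        with (t * (4 / 3 + 2 / 3 * t)) by (field; lra). lra.
    + right. field. lra.
  - transitivity (Re (u * (/ p (RtoC r * e) - 1))%C).
    + replace (u * (/ p (RtoC r * e) - 1))%C with (u * / p (RtoC r * e) + - u)%C by ring.
      rewrite re_plus, re_opp. ring.
    + rewrite E. reflexivity.
Qed.

(* At a first zero of p on a ray 1/p would blow up, while its derivative is bounded
   before that point.  Nothing can be read off at the zero itself, where x / 0 = 0. *)
Lemma nonvanishing (beta : R) (p w : C -> C) :
  beta <> 0 -> (forall z, Cmod z < 1 -> exists l, cderiv p z l) ->
  p (RtoC 0) = RtoC 1 -> car_equation beta p w ->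
  (forall z, Cmod z < 1 -> Cmod (w z) <= Cmod z) ->
  forall z, Cmod z < 1 -> p z <> RtoC 0.
Proof.
  intros Hbeta Hp Hp0 Heq Hw z Hz.
  destruct (polar_form z) as [e [He Ez]].
  set (r := Cmod z) in *. assert (Hr : 0 <= r) by apply Cmod_ge_0.
  assert (Hb : 0 < Rabs beta) by (apply Rabs_pos_lt; exact Hbeta).
  set (S := fun t => 0 <= t <= r /\ forall s, 0 <= s <= t -> p (RtoC s * e)%C <> RtoC 0).
  (* As 4 t/3 + t^2/3 <= 2 for t <= 1, M bounds |1/p| on any zero-free initial segment, so |p| >= c
     = 1/M there. *)
  set (M := 1 + 2 / Rabs beta).
  assert (HM : 0 < 2 / Rabs beta) by (apply Rdiv_lt_0_compat; lra).
  set (c := / M). assert (Hc : 0 < c) by (apply Rinv_0_lt_compat; unfold M; lra).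
  assert (S0 : S 0).
  { split. lra. intros s Hs. replace s with 0 by lra. rewrite Cmult_0_l, Hp0.
    intros X. injection X. lra. }
  assert (Sc : forall t, S t -> c <= Cmod (p (RtoC t * e)%C)).
  { intros t [Ht Hn].
    pose proof (reciprocal_close beta p w e t Hbeta Hp Hp0 Heq Hw He ltac:(lra) Hn) as B.
    specialize (Hn t ltac:(lra)).
    pose proof (Cmod_triangle_minus (/ p (RtoC t * e))%C 1) as B1. rewrite Cmod_1 in B1.
    assert (B2 : Cmod (/ p (RtoC t * e))%C <= M).
    { assert ((4 / 3 * t + t ^ 2 / 3) / Rabs beta <= 2 / Rabs beta).
      { apply Rmult_le_compat_r. apply Rlt_le, Rinv_0_lt_compat, Hb. nra. }
      unfold M. lra. }
    rewrite Cmod_inv in B2 by exact Hn.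
    apply Cmod_gt_0 in Hn.
    rewrite <- (Rinv_inv (Cmod (p (RtoC t * e)%C))).
    apply Rinv_le_contravar. apply Rinv_0_lt_compat, Hn. exact B2. }
  destruct (completeness S) as [tau [U1 U2]].
  { exists r. intros t [Ht _]. lra. } { exists 0. exact S0. }
  assert (Htau : 0 <= tau <= r).
  { split. apply U1, S0. apply U2. intros t [Ht _]. lra. }
  destruct (Hp (RtoC tau * e)%C) as [l Hl]. { rewrite Cmod_ray; lra. }
  destruct (cderiv_ccont _ _ _ Hl (c / 4)) as [d [Hd HH]]. lra.
  assert (Hclose : forall s, Rabs (s - tau) < d -> Cmod (p (RtoC s * e)%C - p (RtoC tau * e)%C) < c / 4).
  { intros s Hs. apply HH.
    replace (RtoC s * e - RtoC tau * e)%C with (RtoC (s - tau) * e)%C by (rewrite RtoC_minus; ring).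
    rewrite Cmod_mult, He, Cmod_R. lra. }
  assert (Ht : exists t, S t /\ tau - d < t).
  { destruct (Classical_Prop.classic (exists t, S t /\ tau - d < t)) as [X|X]. exact X.
    exfalso. assert (tau <= tau - d); [|lra].
    apply U2. intros t HS. apply Rnot_lt_le. intros L. apply X. exists t. split; assumption. }
  destruct Ht as [t [HS Hlt]].
  pose proof (U1 t HS) as Hle.
  (* A zero within d of tau would give |p| < c/4 at tau and so |p| < c/2 at t, against |p| >= c. The
     zero-free segment thus reaches past tau unless it stops at r, and tau is the supremum. *)
  assert (St : S (Rmin (tau + d / 2) r)).
  { pose proof (Rmin_l (tau + d / 2) r). pose proof (Rmin_r (tau + d / 2) r).
    split. { split; [apply Rmin_glb|]; lra. }
    intros s Hs. destruct (Rle_lt_dec s t) as [L|L].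
    - apply HS. lra.
    - pose proof (Hclose s ltac:(apply Rabs_def1; lra)) as C1.
      pose proof (Hclose t ltac:(apply Rabs_def1; lra)) as C2.
      pose proof (Sc t HS) as C3. intros Y. rewrite Y in C1.
      replace (0 - p (RtoC tau * e))%C with (- p (RtoC tau * e))%C in C1 by ring.
      rewrite Cmod_opp in C1.
      pose proof (Cmod_triangle (p (RtoC t * e) - p (RtoC tau * e))%C (p (RtoC tau * e))%C) as C4.
      replace (p (RtoC t * e) - p (RtoC tau * e) + p (RtoC tau * e))%C with (p (RtoC t * e)%C) in C4 by ring.
      lra. }
  pose proof (U1 _ St) as L.
  assert (E : Rmin (tau + d / 2) r = r).
  { unfold Rmin in *. destruct Rle_dec; lra. }
  rewrite E in St. rewrite Ez. apply St. lra.
Qed.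

Lemma reciprocal_close_disc (beta : R) (p w : C -> C) (z : C) :
  beta <> 0 -> (forall z, Cmod z < 1 -> exists l, cderiv p z l) ->
  p (RtoC 0) = RtoC 1 -> car_equation beta p w ->
  (forall z, Cmod z < 1 -> Cmod (w z) <= Cmod z) ->
  Cmod z < 1 -> Cmod (/ p z - 1) < 5 / 3 / Rabs beta.
Proof.
  intros Hbeta Hp Hp0 Heq Hw Hz.
  destruct (polar_form z) as [e [He Ez]].
  assert (Hb : 0 < Rabs beta) by (apply Rabs_pos_lt; exact Hbeta).
  pose proof (Cmod_ge_0 z) as Hr.
  rewrite Ez.
  eapply Rle_lt_trans; [apply (reciprocal_close beta p w e (Cmod z)); try assumption|].
  - split; assumption.
  - intros t Ht. apply (nonvanishing beta p w); try assumption. rewrite Cmod_ray; lra.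
  - apply Rmult_lt_compat_r. apply Rinv_0_lt_compat, Hb. nra.
Qed.

Lemma reciprocal_Re_pos (beta : R) (p w : C -> C) (z : C) :
  beta <= - (4 / 3) -> (forall z, Cmod z < 1 -> exists l, cderiv p z l) ->
  p (RtoC 0) = RtoC 1 -> car_equation beta p w ->
  (forall z, Cmod z < 1 -> Cmod (w z) <= Cmod z) ->
  Cmod z < 1 -> 0 < Re (/ p z)%C.
Proof.
  intros Hbeta Hp Hp0 Heq Hw Hz.
  assert (Hb0 : beta <> 0) by lra.
  destruct (polar_form z) as [e [He Ez]].
  pose proof (Cmod_ge_0 z) as Hr.
  (* With u = -1 the growth estimate bounds 1 - Re (1/p) from above; the constants are those of
     [Re_car] divided by - beta > 0. *)
  pose proof (reciprocal_growth beta p w (RtoC (-1)) e (Cmod z) (4 / 3 / - beta) (- (1 / 3) / - beta)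
    Hb0 Hp Hp0 Heq He ltac:(lra)) as G.
  rewrite <- Ez, !re_scal_l in G. change (Re (RtoC (-1))) with (-1) in G.
  assert (G' : -1 * Re (/ p z)%C - -1 <= 4 / 3 / - beta * Cmod z + - (1 / 3) / - beta * Cmod z ^ 2 / 2).
  { apply G.
    - intros t Ht. apply (nonvanishing beta p w); try assumption. rewrite Cmod_ray; lra.
    - intros t Ht.
      pose proof (Hw (RtoC t * e)%C) as W. rewrite Cmod_ray in W by lra.
      specialize (W ltac:(lra)).
      pose proof (Re_car (w (RtoC t * e)%C) t ltac:(lra)) as B.
      set (g := (4 * w (RtoC t * e) / 3 + 2 * w (RtoC t * e) ^ 2 / 3)%C) in *.
      rewrite re_scal_l.
      replace (- (-1 * Re g) / beta) with ((- Re g) / - beta) by (field; lra).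
      apply Rle_div_l. lra.
      replace (t * (4 / 3 / - beta + - (1 / 3) / - beta * t) * - beta)
        with (t * (4 / 3 + - (1 / 3) * t)) by (field; lra). exact B. }
  replace (4 / 3 / - beta * Cmod z + - (1 / 3) / - beta * Cmod z ^ 2 / 2)
    with ((4 / 3 * Cmod z - Cmod z ^ 2 / 6) / - beta) in G' by (field; lra).
  (* For r = |z| < 1 the numerator 4 r/3 - r^2/6 is below 7/6, hence below 4/3 <= - beta. *)
  assert (X : (4 / 3 * Cmod z - Cmod z ^ 2 / 6) / - beta < 1); [|lra].
  apply Rlt_div_l. lra. nra.
Qed.

(** * Logarithm, powers and the sector *)

Lemma sqrt_1_plus_ratio (x y : R) : 0 < x -> sqrt (1 + (y / x)²) = Cmod (x, y) / x.
Proof.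
  intros Hx. unfold Cmod, Rsqr. simpl.
  replace (1 + y / x * (y / x)) with ((x * (x * 1) + y * (y * 1)) / (x * x)) by (field; lra).
  rewrite sqrt_div_alt, sqrt_square by nra. reflexivity.
Qed.

(** On the right half-plane the two arccosine branches merge into one smooth expression; the
    derivative of [Clog] and its inverse laws with [Cexp] rest on it. *)
Lemma Carg_atan (z : C) : 0 < Re z -> Carg z = atan (Im z / Re z).
Proof.
  destruct z as [x y]. simpl. intros Hx. unfold Carg. simpl.
  assert (Hm : 0 < Cmod (x, y)).
  { pose proof (Rabs_Re_le (x, y)) as H. simpl in H. rewrite Rabs_pos_eq in H; lra. }
  assert (Ec : x / Cmod (x, y) = cos (atan (y / x))).
  { rewrite cos_atan, sqrt_1_plus_ratio by exact Hx. field. lra. }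
  rewrite Ec. pose proof (atan_bound (y / x)) as B. pose proof PI_RGT_0.
  destruct Rle_dec as [L|L].
  - apply acos_cos. split; [|lra]. destruct (Req_dec y 0) as [->|N].
    + unfold Rdiv. rewrite Rmult_0_l, atan_0. lra.
    + rewrite <- atan_0. apply Rlt_le, atan_increasing. apply Rdiv_lt_0_compat; lra.
  - rewrite <- cos_neg, acos_cos. ring. split; [|lra].
    rewrite <- atan_opp, <- atan_0. apply Rlt_le, atan_increasing.
    replace (- (y / x)) with ((- y) / x) by (field; lra). apply Rdiv_lt_0_compat; lra.
Qed.

Lemma Cexp_Clog (z : C) : 0 < Re z -> Cexp (Clog z) = z.
Proof.
  intros Hx. unfold Clog, Cexp. cbn [Re Im fst snd]. rewrite Carg_atan by exact Hx.
  destruct z as [x y]. simpl in *.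
  assert (Hm : 0 < Cmod (x, y)).
  { pose proof (Rabs_Re_le (x, y)) as H. simpl in H. rewrite Rabs_pos_eq in H; lra. }
  rewrite exp_ln, cos_atan, sin_atan, sqrt_1_plus_ratio by assumption.
  f_equal; field; lra.
Qed.

Lemma Clog_Cexp (z : C) : - (PI / 2) < Im z < PI / 2 -> Clog (Cexp z) = z.
Proof.
  intros Hz. unfold Clog. rewrite Cmod_Cexp, ln_exp.
  assert (Hc : 0 < cos (Im z)) by (apply cos_gt_0; lra).
  pose proof (exp_pos (Re z)).
  rewrite Carg_atan. 2: { simpl. apply Rmult_lt_0_compat; assumption. }
  simpl. replace (_ / _) with (tan (Im z)) by (unfold tan; field; lra).
  rewrite atan_tan by lra. destruct z; reflexivity.
Qed.

Lemma cderiv_Clog (z : C) : 0 < Re z -> exists l, cderiv Clog z l.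
Proof.
  destruct z as [x y]. simpl. intros Hx.
  set (s := x * x + y * y). assert (Hs : 0 < s) by (unfold s; nra).
  (* This is conj(z) / |z|^2 = 1/z. *)
  exists (x / s, - y / s).
  pose proof (differentiable_pt_lim_fst x y) as D1.
  pose proof (differentiable_pt_lim_snd x y) as D2.
  apply cauchy_riemann.
  - assert (L : derivable_pt_lim (fun s => ln (sqrt s)) s (/ (2 * s))).
    { apply is_derive_Reals. auto_derive.
      - split. exact Hs. split. apply sqrt_lt_R0, Hs. trivial.
      - pose proof (sqrt_sqrt s ltac:(lra)) as E. pose proof (sqrt_lt_R0 s Hs).
        rewrite <- E at 3. field. lra. }
    apply (differentiable_pt_lim_ext (fun u v => ln (sqrt (u * u + v * v)))).
    { exists (mkposreal 1 Rlt_0_1). intros u v _ _. unfold Clog, Cmod. simpl.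
      rewrite !Rmult_1_r. reflexivity. }
    refine (differentiable_pt_lim_eq _ _ _ _ _ _ _ _ _
      (differentiable_pt_lim_comp_1 _ (fun u v => u * u + v * v) x y _ _ _ L
        (differentiable_pt_lim_plus _ _ _ _ _ _ _ _
          (differentiable_pt_lim_mult _ _ _ _ _ _ _ _ D1 D1)
          (differentiable_pt_lim_mult _ _ _ _ _ _ _ _ D2 D2)))); field; lra.
  - assert (Li : derivable_pt_lim Rinv x (- / (x * x))).
    { apply is_derive_Reals. auto_derive. lra. field. lra. }
    pose proof (derivable_pt_lim_atan (y * / x)) as La.
    apply (differentiable_pt_lim_ext (fun u v => atan (v * / u))).
    { exists (mkposreal x Hx). intros u v Hu _. simpl in Hu. apply Rabs_def2 in Hu.
      unfold Clog. cbn [Im snd]. rewrite Carg_atan by (simpl; lra). reflexivity. }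
    assert (E : 1 + (y * / x) ^ 2 = s / (x * x)) by (unfold s; field; lra).
    refine (differentiable_pt_lim_eq _ _ _ _ _ _ _ _ _
      (differentiable_pt_lim_comp_1 _ (fun u v => v * / u) x y _ _ _ La
        (differentiable_pt_lim_mult _ _ _ _ _ _ _ _ D2
          (differentiable_pt_lim_comp_1 _ (fun u _ => u) x y _ _ _ Li D1))));
      rewrite E; field; lra.
Qed.

Lemma cderiv_Cpowr (f : C -> C) (a : R) (z l : C) :
  0 < Re (f z) -> cderiv f z l -> exists m, cderiv (fun w => Cpowr (f w) a) z m.
Proof.
  intros Hz Hl. destruct (cderiv_Clog _ Hz) as [k Hk].
  eexists. unfold Cpowr.
  apply (cderiv_comp Cexp (fun w => RtoC a * Clog (f w))%C). apply cderiv_Cexp.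
  apply cderiv_mult. apply cderiv_const.
  exact (cderiv_comp Clog f z _ _ Hk Hl).
Qed.

(** Dividing an argument smaller than a pi/2 by a leaves it inside (- pi/2, pi/2), where the cosine
    is positive and [Clog] undoes [Cexp]. *)
Lemma Cpowr_inverse (z : C) (a : R) :
  0 < a -> 0 < Re z -> Rabs (Carg z) < a * PI / 2 ->
  0 < Re (Cpowr z (/ a)) /\ Cpowr (Cpowr z (/ a)) a = z.
Proof.
  intros Ha Hz Hc.
  assert (Hi : - (PI / 2) < Im (RtoC (/ a) * Clog z)%C < PI / 2).
  { rewrite im_scal_l. simpl. apply Rabs_def2 in Hc.
    assert (E : forall t, / a * t = t / a) by (intros; field; lra). rewrite E.
    split; [apply Rlt_div_r | apply Rlt_div_l]; lra. }
  split.
  - unfold Cpowr, Cexp. cbn [Re fst]. apply Rmult_lt_0_compat. apply exp_pos. apply cos_gt_0; apply Hi.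
  - unfold Cpowr at 1. unfold Cpowr. rewrite Clog_Cexp by exact Hi.
    rewrite Cmult_assoc, <- RtoC_mult, Rinv_r, Cmult_1_l by lra. apply Cexp_Clog. exact Hz.
Qed.

Lemma Cpowr_1_l (a : R) : Cpowr (RtoC 1) a = RtoC 1.
Proof.
  unfold Cpowr, Clog. rewrite Carg_atan, Cmod_1, ln_1 by (simpl; lra). simpl.
  unfold Rdiv. rewrite Rmult_0_l, atan_0.
  unfold Cexp, Cmult, RtoC. simpl. replace (a * 0 - 0 * 0) with 0 by ring.
  replace (a * 0 + 0 * 0) with 0 by ring. rewrite exp_0, cos_0, sin_0. f_equal; ring.
Qed.

(** The tangents from 0 to the circle of radius sin a about 1 make the angle a with the real axis,
    and p and 1/p have opposite arguments. For p = x + i y the hypothesis becomes cos^2 a y^2 + (x -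
    1)^2 < sin^2 a x^2. *)
Lemma sector_of_reciprocal (p : C) (a : R) :
  0 < a < PI / 2 -> p <> RtoC 0 -> Cmod (/ p - 1)%C < sin a -> 0 < Re p /\ Rabs (Carg p) < a.
Proof.
  intros Ha Hp H.
  assert (Hc : 0 < cos a) by (apply cos_gt_0; lra).
  assert (Hs : 0 < sin a) by (apply sin_gt_0; lra).
  pose proof (sin2_cos2 a) as SC. unfold Rsqr in SC.
  assert (Hm : 0 < Cmod p) by (apply Cmod_gt_0; exact Hp).
  assert (H1 : Cmod (p - 1)%C < sin a * Cmod p).
  { replace (p - 1)%C with (- (/ p - 1) * p)%C by (field; exact Hp).
    rewrite Cmod_mult, Cmod_opp. apply Rmult_lt_compat_r; assumption. }
  assert (H2 : Cmod (p - 1)%C * Cmod (p - 1)%C < sin a * Cmod p * (sin a * Cmod p)).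
  { apply Rmult_le_0_lt_compat; try apply Cmod_ge_0; exact H1. }
  rewrite Cmod_sqr in H2.
  replace (sin a * Cmod p * (sin a * Cmod p)) with (sin a * sin a * (Cmod p * Cmod p)) in H2 by ring.
  rewrite Cmod_sqr in H2. clear H H1 Hm.
  destruct p as [x y]. simpl in H2.
  replace (sin a * sin a) with (1 - cos a * cos a) in H2 by lra.
  replace (y + - 0) with y in H2 by ring.
  (* The squared inequality rearranges to cos^2 a (x^2 + y^2) + 1 < 2 x. *)
  assert (Hx : 0 < x).
  { pose proof (Rle_0_sqr (cos a * x)). pose proof (Rle_0_sqr (cos a * y)). unfold Rsqr in *. nra. }
  assert (Hy : (cos a * y) * (cos a * y) < (sin a * x) * (sin a * x)).
  { replace (sin a * x * (sin a * x)) with (sin a * sin a * (x * x)) by ring.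
    replace (sin a * sin a) with (1 - cos a * cos a) by lra. 
    pose proof (Rle_0_sqr (x + - (1))). unfold Rsqr in *. lra. }
  split. exact Hx.
  assert (Hsx : 0 < sin a * x) by (apply Rmult_lt_0_compat; assumption).
  assert (Hb : - (sin a * x) < cos a * y < sin a * x) by (split; nra).
  assert (Et : sin a * x = cos a * (tan a * x)) by (unfold tan; field; lra).
  rewrite Et in Hb.
  assert (Hb1 : y < tan a * x) by (apply (Rmult_lt_reg_l (cos a)); lra).
  assert (Hb2 : - (tan a * x) < y) by (apply (Rmult_lt_reg_l (cos a)); lra).
  rewrite Carg_atan by exact Hx. simpl.
  apply Rabs_def1.
  - rewrite <- (atan_tan a) by lra. apply atan_increasing. apply Rlt_div_l; lra.
  - rewrite <- (atan_tan a) at 1 by lra. rewrite <- atan_opp. apply atan_increasing.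
    apply Rlt_div_r; lra.
Qed.

(** * Real inequalities behind the numerical condition of case (b) *)

Lemma jordan_sin (t : R) : 0 < t < 1 -> t <= sin (t * PI / 2).
Proof.
  intros Ht. pose proof PI_RGT_0.
  set (x := t * PI / 2). assert (Hx : 0 < x < PI / 2) by (unfold x; nra).
  (* This is the sign of the numerator of (sin y / y)', so sin y / y is nonincreasing and is
     compared with its value at pi/2. *)
  assert (K : forall y, 0 <= y <= PI / 2 -> y * cos y - sin y <= 0).
  { intros y Hy.
    replace 0 with (0 * cos 0 - sin 0) by (rewrite sin_0; ring).
    apply (nonincreasing_of_derivative (fun y => y * cos y - sin y) 0 y (proj1 Hy)).
    - intros u _. apply (ex_derive_continuous (K := R_AbsRing) (V := R_NormedModule)). auto_derive. trivial.
    - intros u Hu. exists (- (u * sin u)). split. auto_derive. trivial. ring.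
      assert (0 < sin u) by (apply sin_gt_0; lra). nra. }
  assert (Q : sin (PI / 2) / (PI / 2) <= sin x / x).
  { apply (nonincreasing_of_derivative (fun y => sin y / y) x (PI / 2)). lra.
    - intros u Hu. apply (ex_derive_continuous (K := R_AbsRing) (V := R_NormedModule)). auto_derive. lra.
    - intros u Hu. exists ((u * cos u - sin u) / (u * u)). split. auto_derive. lra. field. lra.
      apply Rle_div_l. nra. rewrite Rmult_0_l. apply K. lra. }
  rewrite sin_PI2 in Q. apply (Rmult_le_compat_r x) in Q; [|lra].
  replace (sin x / x * x) with (sin x) in Q by (field; lra).
  replace (1 / (PI / 2) * x) with t in Q by (unfold x; field; lra). exact Q.
Qed.

(** After taking logarithms the claim is (1 - a) ln (1 - a) + (1 + a) ln (1 + a) >= 0. By x ln x >=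
    x - 1 the two terms are at least - a and a. *)
Lemma Rpower_ratio_le (a : R) : 0 < a < 1 -> Rpower ((1 - a) / (1 + a)) a <= 1 - a ^ 2.
Proof.
  intros Ha.
  assert (L : forall x, 0 < x -> 1 - / x <= ln x).
  { intros x Hx. pose proof (exp_ineq1_le (ln (/ x))) as E.
    rewrite exp_ln in E by (apply Rinv_0_lt_compat, Hx). rewrite ln_Rinv in E by exact Hx. lra. }
  rewrite <- (exp_ln (1 - a ^ 2)) by nra. unfold Rpower.
  assert (M : forall u v, u <= v -> exp u <= exp v).
  { intros u v [Huv| ->]; [left; apply exp_increasing, Huv | right; reflexivity]. }
  apply M.
  replace (1 - a ^ 2) with ((1 - a) * (1 + a)) by ring.
  rewrite ln_mult, ln_div by lra.
  pose proof (L (1 + a) ltac:(lra)) as L1. pose proof (L (1 - a) ltac:(lra)) as L2.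
  apply (Rmult_le_compat_l (1 + a)) in L1; [|lra].
  apply (Rmult_le_compat_l (1 - a)) in L2; [|lra].
  replace ((1 + a) * (1 - / (1 + a))) with a in L1 by (field; lra).
  replace ((1 - a) * (1 - / (1 - a))) with (- a) in L2 by (field; lra). lra.
Qed.

Lemma power_condition (alpha beta : R) :
  beta > 0 -> 0 < alpha < 1 ->
  9 * alpha ^ 2 * beta ^ 2
     * Rpower ((1 - alpha) / (1 + alpha)) alpha
     * Rpower (1 - alpha ^ 2) (-2)
     * (-8 + alpha ^ 2
             * (8 + 3 * beta ^ 2 * Rpower ((1 - alpha) / (1 + alpha)) alpha))
   - 64 * alpha * beta
     * Rpower (1 - alpha ^ 2) (- (1 / 2))
     * Rpower (sqrt ((1 - alpha) / (1 + alpha))) alpha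
     * sin (alpha * PI / 2) >= 16 ->
  5 / 3 / beta <= sin (alpha * PI / 2).
Proof.
  intros Hb Ha H.
  pose proof (jordan_sin alpha Ha) as J.
  pose proof (Rpower_ratio_le alpha Ha) as HA.
  set (s := (1 - alpha) / (1 + alpha)) in *.
  assert (Hs : 0 < s) by (apply Rdiv_lt_0_compat; lra).
  set (B := Rpower (sqrt s) alpha) in *.
  assert (EA : Rpower s alpha = B * B).
  { unfold B. rewrite Rpower_mult_distr by (apply sqrt_lt_R0, Hs). rewrite sqrt_sqrt; lra. }
  assert (HB : 0 < B) by apply exp_pos.
  rewrite EA in *.
  assert (Hm : 0 < 1 - alpha ^ 2) by nra.
  replace (-2) with (- (2)) in H by ring.
  rewrite !Rpower_Ropp in H.
  replace (Rpower (1 - alpha ^ 2) (1 / 2)) with (sqrt (1 - alpha ^ 2)) in H.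
  2: { rewrite <- Rpower_sqrt by exact Hm. f_equal. field. }
  replace (Rpower (1 - alpha ^ 2) 2) with ((1 - alpha ^ 2) ^ 2) in H.
  2: { rewrite <- Rpower_pow by exact Hm. reflexivity. }
  assert (En : 1 - alpha ^ 2 = sqrt (1 - alpha ^ 2) * sqrt (1 - alpha ^ 2)) by (rewrite sqrt_sqrt; lra).
  assert (Hn : 0 < sqrt (1 - alpha ^ 2)) by (apply sqrt_lt_R0; exact Hm).
  set (n := sqrt (1 - alpha ^ 2)) in *.
  set (S := sin (alpha * PI / 2)) in *.
  replace (-8 + alpha ^ 2 * (8 + 3 * beta ^ 2 * (B * B)))
    with (-8 * (n * n) + 3 * alpha ^ 2 * beta ^ 2 * (B * B)) in H by (rewrite <- En; ring).
  rewrite En in H, HA.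
  (* With n^2 = 1 - alpha^2 and B^2 the power of s, every term of the condition is a monomial in v,
     apart from the factor S. *)
  set (v := alpha * beta * B / n).
  assert (Hab : 0 < alpha * beta) by nra.
  assert (Hv : 0 < v). { unfold v. apply Rdiv_lt_0_compat. apply Rmult_lt_0_compat; lra. exact Hn. }
  assert (H' : 27 * v ^ 4 - 72 * v ^ 2 - 64 * v * S >= 16).
  { eapply Rge_trans; [right|exact H]. unfold v. field. lra. }
  assert (HS : 0 < S) by lra.
  (* At v = 5/3 the polynomial 27 v^4 - 72 v^2 is only 25/3 < 16, it stays below 16 for smaller
     positive v, and the sine term is subtracted. *)
  assert (V : 5 / 3 <= v).
  { apply Rnot_lt_le. intros V. assert (V2 : v ^ 2 < 25 / 9) by nra.
    assert (v ^ 2 * (27 * v ^ 2 - 72) < 16) by nra. nra. }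
  (* B^2 <= n^2 is [Rpower_ratio_le]. Hence v <= alpha beta, and Jordan's inequality replaces alpha
     by the sine. *)
  assert (HBn : B <= n) by nra.
  assert (Ev : v * n = alpha * beta * B) by (unfold v; field; lra).
  assert (Hab2 : 5 / 3 <= alpha * beta).
  { apply (Rmult_le_reg_r n). exact Hn.
    apply (Rle_trans _ (alpha * beta * B)). rewrite <- Ev. apply Rmult_le_compat_r; lra.
    apply Rmult_le_compat_l; lra. }
  apply Rle_div_l. lra. apply (Rle_trans _ (alpha * beta)). exact Hab2.
  apply Rmult_le_compat_r; lra.
Qed.

(** * The Cayley map and subordination to the right half-plane *)

Lemma one_minus_neq_0 (z : C) : Cmod z < 1 -> (1 - z)%C <> RtoC 0.
Proof.
  intros Hz E. assert (z = RtoC 1) as ->. { transitivity (1 - (1 - z))%C. ring. rewrite E. ring. }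
  rewrite Cmod_1 in Hz. lra.
Qed.

Lemma cderiv_cayley (z : C) : Cmod z < 1 -> exists l, cderiv (fun z => (1 + z) / (1 - z))%C z l.
Proof.
  intros Hz. eexists. apply cderiv_div. apply one_minus_neq_0, Hz.
  - apply cderiv_plus. apply cderiv_const. apply cderiv_id.
  - apply cderiv_minus. apply cderiv_const. apply cderiv_id.
Qed.

Lemma Re_cayley_pos (z : C) : Cmod z < 1 -> 0 < Re ((1 + z) / (1 - z))%C.
Proof.
  intros Hz. pose proof (one_minus_neq_0 z Hz) as Hn. apply Cmod_gt_0 in Hn.
  pose proof (Cmod_sqr (1 - z)) as E. apply Cmod_lt_1_iff in Hz. 
  destruct z as [x y]. simpl in *. 
  assert (0 < (1 + - x) * (1 + - x) + (0 + - y) * (0 + - y)) by nra.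
  set (D := (1 + - x) * ((1 + - x) * 1) + (0 + - y) * ((0 + - y) * 1)).
  assert (HD : 0 < D) by (unfold D; lra).
  replace (_ - _) with ((1 - (x * x + y * y)) / D) by (field; lra).
  apply Rdiv_lt_0_compat; lra.
Qed.

(** The Schwarz function is the inverse Cayley transform (P - 1)/(P + 1); |P - 1| < |P + 1|
    expresses that P is nearer to 1 than to -1, that is Re P > 0. *)
Lemma half_plane_subordination (P : C -> C) :
  (forall z, Cmod z < 1 -> exists l, cderiv P z l) ->
  (forall z, Cmod z < 1 -> 0 < Re (P z)) -> P (RtoC 0) = RtoC 1 ->
  exists w : C -> C,
    analytic_on_disc w /\ (forall z, Defs.disc z -> Defs.disc (w z)) /\ w (RtoC 0) = RtoC 0 /\
    (forall z, Defs.disc z -> P z = ((1 + w z) / (1 - w z))%C).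
Proof.
  intros Hd Hre H0.
  assert (Hn : forall z, Cmod z < 1 -> (P z + 1)%C <> RtoC 0).
  { intros z Hz E. pose proof (Hre z Hz) as X.
    assert (Y : Re (P z + 1)%C = 0) by (rewrite E; reflexivity). rewrite re_plus in Y. simpl in Y. lra. }
  exists (fun z => (P z - 1) / (P z + 1))%C. split; [|split; [|split]].
  - intros z Hz. apply ex_cderiv. destruct (Hd z Hz) as [l Hl]. eexists.
    apply cderiv_div. apply Hn, Hz.
    + apply cderiv_minus. exact Hl. apply cderiv_const.
    + apply cderiv_plus. exact Hl. apply cderiv_const.
  - intros z Hz. unfold Defs.disc. pose proof (Hn z Hz) as N. rewrite Cmod_div by exact N.
    apply Cmod_gt_0 in N. apply Rlt_div_l. exact N. rewrite Rmult_1_l.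
    pose proof (Cmod_sqr (P z - 1)) as E1. pose proof (Cmod_sqr (P z + 1)) as E2.
    pose proof (Hre z Hz) as X. pose proof (Cmod_ge_0 (P z - 1)).
    destruct (P z) as [x y]. simpl in E1, E2, X. nra.
  - rewrite H0. unfold Cminus. rewrite Cplus_opp_r. unfold Cdiv. ring.
  - intros z Hz. pose proof (Hn z Hz) as N.
    assert ((1 - (P z - 1) / (P z + 1))%C <> RtoC 0).
    { replace (1 - (P z - 1) / (P z + 1))%C with (2 / (P z + 1))%C by (field; exact N).
      apply Cmult_neq_0. intros X. injection X. lra.
      intros X. apply (f_equal (fun t => t * (P z + 1))%C) in X. rewrite Cinv_l in X by exact N.
      rewrite Cmult_0_l in X. injection X. lra. }
    field. split. exact N.
    intros X. apply (f_equal Re) in X. revert X. 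
    replace (P z + 1 - (P z - 1))%C with (RtoC 2) by ring. simpl. lra.
Qed.

Lemma Re_inv_pos (z : C) : 0 < Re (/ z)%C -> 0 < Re z.
Proof.
  destruct z as [x y]. simpl. intros H.
  apply Rnot_le_lt. intros L. 
  assert (0 <= x * (x * 1) + y * (y * 1)) by nra.
  destruct (Req_dec (x * (x * 1) + y * (y * 1)) 0) as [E|E].
  - assert (x = 0) by nra. subst. unfold Rdiv in H. lra.
  - assert (0 < / (x * (x * 1) + y * (y * 1))) by (apply Rinv_0_lt_compat; lra).
    unfold Rdiv in H. nra.
Qed.

Theorem theorem3p2 (beta : R) (p : C -> C)
  (p_analytic : analytic_on_disc p)
  (p_at_0 : p (RtoC 0) = RtoC 1)
  (p_sub : subordinate
             (fun z : C => (1 + RtoC beta * ((z * C_derive p z) / (p z) ^ 2))%C)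
             phi_CAR) :
  (beta >= 4 \/ beta <= - (4 / 3) ->
   subordinate p (fun z : C => ((1 + z) / (1 - z))%C))
  /\
  (forall alpha : R,
   beta > 0 -> 0 < alpha < 1 ->
   9 * alpha ^ 2 * beta ^ 2
     * Rpower ((1 - alpha) / (1 + alpha)) alpha
     * Rpower (1 - alpha ^ 2) (-2)
     * (-8 + alpha ^ 2
             * (8 + 3 * beta ^ 2 * Rpower ((1 - alpha) / (1 + alpha)) alpha))
   - 64 * alpha * beta
     * Rpower (1 - alpha ^ 2) (- (1 / 2))
     * Rpower (sqrt ((1 - alpha) / (1 + alpha))) alpha
     * sin (alpha * PI / 2) >= 16 ->
   subordinate p (fun z : C => Cpowr ((1 + z) / (1 - z))%C alpha)).
Proof.
  destruct p_sub as (_ & _ & w & w_an & w_disc & w_0 & w_eq).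
  assert (Hp : forall z, Cmod z < 1 -> exists l, cderiv p z l).
  { intros z Hz. apply ex_cderiv, p_analytic, Hz. }
  assert (Hw : forall z, Cmod z < 1 -> Cmod (w z) <= Cmod z).
  { intros z Hz. apply schwarz; try assumption. intros y Hy. apply ex_cderiv, w_an, Hy. }
  assert (Heq : car_equation beta p w).
  { intros z l Hz Hl. specialize (w_eq z Hz). unfold phi_CAR in w_eq.
    rewrite (is_C_derive_unique p z l) in w_eq by (apply cderiv_is_derive, Hl).
    transitivity ((1 + RtoC beta * (z * l / p z ^ 2)) - 1)%C; [ring|].
    rewrite w_eq. ring. }
  split.
  - intros Hb.
    assert (Hre : forall z, Cmod z < 1 -> 0 < Re (p z)).
    { intros z Hz. apply Re_inv_pos. destruct Hb as [Hb|Hb].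
      (* For beta >= 4 the radius 5/(3 beta) is at most 5/12 < 1, so the disc about 1 stays in the
         right half-plane. *)
      - pose proof (reciprocal_close_disc beta p w z ltac:(lra) Hp p_at_0 Heq Hw Hz) as B.
        rewrite Rabs_pos_eq in B by lra. apply Rlt_div_r in B; [|lra].
        pose proof (Rabs_Re_le (/ p z - 1)) as B'. pose proof (Cmod_ge_0 (/ p z - 1)).
        replace (Re (/ p z - 1)%C) with (Re (/ p z)%C - 1) in B' by reflexivity.
        apply Rabs_le_between in B'. nra.
      - exact (reciprocal_Re_pos beta p w z Hb Hp p_at_0 Heq Hw Hz). }
    split; [exact p_analytic|]. split.
    + intros z Hz. apply ex_cderiv, cderiv_cayley, Hz.
    + exact (half_plane_subordination p Hp Hre p_at_0).
  - intros alpha Hb Ha Hcond. apply power_condition in Hcond; try assumption.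
    pose proof PI_RGT_0 as HPI.
    assert (Hsec : forall z, Cmod z < 1 -> 0 < Re (p z) /\ Rabs (Carg (p z)) < alpha * PI / 2).
    { intros z Hz. apply sector_of_reciprocal.
      - nra.
      - apply (nonvanishing beta p w); try assumption. lra.
      - eapply Rlt_le_trans; [|exact Hcond].
        pose proof (reciprocal_close_disc beta p w z ltac:(lra) Hp p_at_0 Heq Hw Hz) as B.
        rewrite Rabs_pos_eq in B by lra. exact B. }
    (* As p stays in the sector of half-angle alpha pi/2, its power 1/alpha maps into the right
       half-plane. The Schwarz function of that power also serves p, since raising to the power
       alpha recovers p. *)
    destruct (half_plane_subordination (fun z => Cpowr (p z) (/ alpha))) as (v & v_an & v_disc & v_0 & v_eq).
    + intros z Hz. destruct (Hp z Hz) as [l Hl]. apply (cderiv_Cpowr p _ z l). apply Hsec, Hz. exact Hl.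
    + intros z Hz. apply Cpowr_inverse. lra. apply Hsec, Hz. apply Hsec, Hz.
    + rewrite p_at_0. apply Cpowr_1_l.
    + split; [exact p_analytic|]. split.
      * intros z Hz. apply ex_cderiv. destruct (cderiv_cayley z Hz) as [l Hl].
        apply (cderiv_Cpowr (fun z => (1 + z) / (1 - z))%C _ z l). apply Re_cayley_pos, Hz. exact Hl.
      * exists v. repeat split; try assumption.
        intros z Hz. rewrite <- (v_eq z Hz). symmetry.
        apply Cpowr_inverse. lra. apply Hsec, Hz. apply Hsec, Hz.
Qed.
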